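(* Let $1\le m\le n$ and $k\ge1$ be integers, $0\le\alpha\le1$, $A\subseteq\mathbb{R}^n$ and $a\in\mathbb{R}^n$. Suppose $A$ is approximately differentiable of order $(k,\alpha)$ at $a$ and $m=\dim\mathrm{ap\,Tan}(A,a)$. Then there exists $B\subseteq A$ which is pointwise differentiable of order $(k,\alpha)$ at $a$ such that $$\boldsymbol{\Theta}^m(\mathscr{H}^m\llcorner(A\setminus B),a)=0,$$ $$\mathrm{ap\,Tan}(A,a)=\mathrm{Tan}(B,a)=\mathrm{Tan}^m(\mathscr{H}^m\llcorner B,a),$$ $$\mathrm{pt\,D}^iB(a,\mathrm{Tan}(B,a))=\mathrm{ap\,D}^iA(a)\quad\text{for } i=2,\ldots,k.$$
   Context: Notation. $\mathscr{H}^m$ is the $m$ dimensional Hausdorff measure on $\mathbb{R}^n$, regarded as an outer measure on all subsets; $\boldsymbol{\alpha}(m)$ is the Lebesgue measure of the unit ball of $\mathbb{R}^m$; $\mathbf{B}(a,r)$, $\mathbf{U}(a,r)$ are the closed and open balls. $(\phi\llcorner S)(R)=\phi(S\cap R)$. $\boldsymbol{\Theta}^{*m}(\phi,a)=\limsup_{r\to0+}\frac{\phi(\mathbf{B}(a,r))}{\boldsymbol{\alpha}(m)r^m}$, $\boldsymbol{\Theta}^m(\phi,a)$ is the corresponding limit. $\mathbf{G}(n,m)$ is the set of $m$ dimensional linear subspaces of $\mathbb{R}^n$; $T_\natural$ is the orthogonal projection onto $T\in\mathbf{G}(n,m)$, $T^\perp$ its orthogonal complement, $T^\perp_\natural$ the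 projection onto $T^\perp$. $\boldsymbol{\delta}_B(x)=\inf\{|x-b|:b\in B\}$; $\mathrm{gr}(f)=\{\chi+f(\chi):\chi\in T\}$ for $f:T\to T^\perp$; $\mathbf{C}(T,a,s,t)=\{x:|T_\natural(x-a)|<s,\ |T^\perp_\natural(x-a)|<t\}$. Approximate differentiability. Let $A_1=\{x-a:x\in A\}$. $A$ is approximately differentiable of order $(k,\alpha)$ at $a$ if there exist an integer $1\le m\le n$, $T\in\mathbf{G}(n,m)$ and a polynomial function $P:T\to T^\perp$ of degree at most $k$ with $P(0)=0$, $\mathrm{D}P(0)=0$ such that: (1) for every $\epsilon>0$ there exist $\rho>0$, $\eta>0$ with $\mathscr{H}^m(\mathbf{C}(T,z,\epsilon r,\epsilon r)\cap A_1)\ge\eta r^m$ for all $0\le r\le\rho$ and $z\in T\cap\mathbf{B}(0,r)$; (2) for every $\epsilon>0$, $\lim_{r\to0+}\frac{\mathscr{H}^m(A_1\cap\mathbf{B}(0,r)\cap\{z:\boldsymbol{\delta}_{\mathrm{gr}(P)}(z)>\epsilon r^k\})}{\boldsymbol{\alpha}(m)r^m}=0$, and, if $\alpha>0$, there exists $0\le\lambda<\infty$ with $\lim_{r\to0+}\frac{\mathscr{H}^m(A_1\cap\mathbf{B}(0,r)\cap\{z:\boldsymbol{\delta}_{\mathrm{gr}(P)}(z)>\lambda r^{k+\alpha}\})}{\boldsymbol{\alpha}(m)r^m}=0$. ''Order $k$'' means order $(k,0)$. Here $m,T$ are uniquely determined by $A,a$, and $P$ by $A,a,k$. $\mathrm{ap\,Tan}(A,a)=T$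 (defined when $A$ is approximately differentiable of order $1$ at $a$). For $i\ge2$, if $A$ is approximately differentiable of order $i$ at $a$, $\mathrm{ap\,D}^iA(a)=\mathrm{D}^i(P\circ T_\natural)(0)$, where $T=\mathrm{ap\,Tan}(A,a)$ and $P:T\to T^\perp$ is the unique polynomial function of degree at most $i$ with $P(0)=0$, $\mathrm{D}P(0)=0$ such that conditions (1) and (2) hold with $m=\dim T$, $k=i$ and $\alpha=0$ (a symmetric $i$ linear map on $\mathbb{R}^n$ with values in $\mathbb{R}^n$). Approximate tangent cones. For a measure $\phi$ over $\mathbb{R}^n$, $\mathrm{Tan}^{*m}(\phi,a)$ is the set of $v$ such that $\boldsymbol{\Theta}^{*m}(\phi\llcorner\mathbf{E}(a,v,\epsilon),a)>0$ for every $\epsilon>0$, where $\mathbf{E}(a,v,\epsilon)=\{x:|r(x-a)-v|<\epsilon\text{ for some }0<r<\infty\}$; $\mathrm{Tan}^m_*(\phi,a)$ is the set of $v$ such that for every $\epsilon>0$ there is $\eta>0$ with $\phi(\mathbf{U}(a+rv,\epsilon r))\ge\eta r^m$ for $0<r\le\eta$. If they coincide, the common set is $\mathrm{Tan}^m(\phi,a)$. Tangent cones. $\mathrm{Tan}^*(B,a)=\{v:\liminf_{r\to0+}r^{-1}\boldsymbol{\delta}_B(a+rv)=0\}$, $\mathrm{Tan}_*(B,a)=\{v:\lim_{r\to0+}r^{-1}\boldsymbol{\delta}_B(a+rv)=0\}$; if they coincide, the common set is $\mathrm{Tan}(B,a)$. Pointwise differentiability. A map is of class $(k,\alpha)$ if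 it is of class $C^k$ and its $k$-th derivative is locally Hölder continuous with exponent $\alpha$ (no extra condition if $\alpha=0$). $M\subseteq\mathbb{R}^n$ is a submanifold of class $(k,\alpha)$ of dimension $\mu$ if locally, near each of its points, it is mapped onto an open piece of a $\mu$ dimensional linear subspace by a diffeomorphism of class $(k,\alpha)$ (with inverse of the same class) between open subsets of $\mathbb{R}^n$. $B\subseteq\mathbb{R}^n$ is pointwise differentiable of order $(k,\alpha)$ at $a$ if there is a submanifold $M\subseteq\mathbb{R}^n$ of class $(k,\alpha)$ with $a\in M$, $\lim_{r\to0+}r^{-1}\sup\{|\boldsymbol{\delta}_M(x)-\boldsymbol{\delta}_B(x)|:x\in\mathbf{B}(a,r)\}=0$, and $\lim_{r\to0+}r^{-k}\sup\{\boldsymbol{\delta}_M(x):x\in\mathbf{B}(a,r)\cap B\}=0$ if $\alpha=0$, respectively $\limsup_{r\to0+}r^{-k-\alpha}\sup\{\boldsymbol{\delta}_M(x):x\in\mathbf{B}(a,r)\cap B\}<\infty$ if $\alpha>0$. Pointwise differentials. Suppose $B$ is pointwise differentiable of order $k$ (that is, $(k,0)$) at $a$; then $\mathrm{Tan}(B,a)$ is a linear subspace. For $S=\mathrm{Tan}(B,a)$ and $i=0,\ldots,k$, $\mathrm{pt\,D}^iB(a,S)=\mathrm{D}^i(f\circ S_\natural)(a)$, where $f:S\to S^\perp$ is any function of class $k$ such that $a\in\mathrm{gr}(f)$ and the conditions for pointwise differentiability of order $(k,0)$ of $B$ at $a$ hold with $M=\mathrm{gr}(f)$ (such $f$ exists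 and the value does not depend on its choice). *)

(* Defs.v *)
From mathcomp Require Import all_boot all_order all_algebra.
From mathcomp Require Import all_classical all_reals all_analysis.

Set Implicit Arguments.
Unset Strict Implicit.
Unset Printing Implicit Defensive.

Import Order.TTheory GRing.Theory Num.Theory.
Import numFieldNormedType.Exports.

Local Open Scope classical_set_scope.
Local Open Scope ring_scope.

(* The library norm on ['rV[R]_n] is the maximum norm, so the Euclidean metric
   notions are defined here. The library topology and differential do not depend
   on the choice of the norm and are used as they are. *)
Section Euclidean.
Context {R : realType} {n : nat}.
Implicit Types (x y a v : 'rV[R]_n) (B : set 'rV[R]_n) (T : {vspace 'rV[R]_n}).

Definition dotv x y : R := \sum_i x ord0 i * y ord0 i.

Definition enorm x : R := Num.sqrt (dotv x x).

Definition cballE a (r : R) : set 'rV[R]_n := [set x | enorm (x - a) <= r].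

Definition oballE a (r : R) : set 'rV[R]_n := [set x | enorm (x - a) < r].

(* equal to [+oo] when [B] is empty *)
Definition edistE B x : \bar R := ereal_inf [set (enorm (x - b))%:E | b in B].

Definition diamE B : \bar R :=
  ereal_sup [set z | exists x y, [/\ B x, B y & z = (enorm (x - y))%:E]].

Definition orthv T : {vspace 'rV[R]_n} :=
  lker (linfun (mulmxr (\matrix_(i < \dim T) (vbasis T)`_i)^T)).

Definition orthproj T : 'rV[R]_n -> 'rV[R]_n := daddv_pi T (orthv T).

Definition cyl T a (s t : R) : set 'rV[R]_n :=
  [set x | enorm (orthproj T (x - a)) < s /\
           enorm (orthproj (orthv T) (x - a)) < t].

(* A map [T -> T^\perp] is represented by an ambient map, of which only the
   values on [T] are ever used. *)
Definition maps_to_orth T (f : 'rV[R]_n -> 'rV[R]_n) : Prop :=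
  forall x, x \in T -> f x \in orthv T.

Definition gr T (f : 'rV[R]_n -> 'rV[R]_n) : set 'rV[R]_n :=
  [set x + f x | x in [set x | x \in T]].

(* polynomial functions on [T] of degree at most [k], written in the linear
   coordinates given by a basis of [T]; [b] runs over the multi-indices *)
Definition polyfun_on T (k : nat) (P : 'rV[R]_n -> 'rV[R]_n) : Prop :=
  exists c : {ffun 'I_(\dim T) -> 'I_k.+1} -> 'rV[R]_n,
    forall x, x \in T ->
      P x = \sum_(b : {ffun 'I_(\dim T) -> 'I_k.+1} | (\sum_i b i <= k)%N)
              (\prod_i coord (vbasis T) i x ^+ b i) *: c b.

End Euclidean.

Section OrthogonalProjectionFacts.
Context {R : realType} {n : nat}.
Implicit Types (x y : 'rV[R]_n) (T : {vspace 'rV[R]_n}).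

Lemma mem_orthv T y : reflect (forall x, x \in T -> dotv x y = 0) (y \in orthv T).
Proof.
have E (i : 'I_(\dim T)) :
    (y *m (\matrix_(i < \dim T) (vbasis T)`_i)^T) ord0 i = dotv (vbasis T)`_i y.
  by rewrite mxE; apply: eq_bigr => j _; rewrite !mxE mulrC.
rewrite /orthv memv_ker lfunE /=; apply: (iffP eqP) => [y0 x xT | y0].
  rewrite (coord_vbasis xT) /dotv.
  under eq_bigr => i _ do rewrite summxE mulr_suml.
  rewrite exchange_big /= big1// => j _.
  under eq_bigr => i _ do rewrite mxE -mulrA.
  rewrite -mulr_sumr.
  by have := E j; rewrite y0 mxE /dotv => <-; rewrite mulr0.
by apply/rowP => i; rewrite E mxE y0// vbasis_mem// mem_nth// size_tuple.
Qed.

Lemma dotv_eq0 x : dotv x x = 0 -> x = 0.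
Proof.
move=> /eqP; rewrite /dotv psumr_eq0 => [/allP x0|i _]; last exact: sqr_ge0.
apply/rowP => i; rewrite mxE; have := x0 i; rewrite mem_index_enum => /(_ isT).
by rewrite mulf_eq0 orbb => /eqP.
Qed.

Lemma capv_orthv T : (T :&: orthv T = 0)%VS.
Proof.
apply/eqP; rewrite -subv0; apply/subvP => x; rewrite memv_cap memv0.
by move=> /andP[xT /mem_orthv/(_ _ xT)/dotv_eq0 ->].
Qed.

Lemma addv_orthv T : (T + orthv T = fullv)%VS.
Proof.
apply/eqP; rewrite eqEdim subvf/= dimv_disjoint_sum ?capv_orthv//.
rewrite /orthv; set f : 'Hom(_, _) := linfun _.
rewrite -(limg_ker_dim f fullv) capfv addnC leq_add2r.
by rewrite (leq_trans (dimvS (subvf _)))// dimvf /dim/= mul1n.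
Qed.

Lemma orthproj_mem T x : orthproj T x \in T.
Proof. exact: memv_pi. Qed.

Lemma sub_orthproj_mem T x : x - orthproj T x \in orthv T.
Proof.
have xf : x \in (T + orthv T)%VS by rewrite addv_orthv memvf.
rewrite -{1}(daddv_pi_add (capv_orthv T) xf) /orthproj addrAC subrr add0r.
exact: memv_pi.
Qed.

End OrthogonalProjectionFacts.

Section HausdorffMeasure.
Context {R : realType}.

Definition lebesgue_outer (m : nat) (A : set 'rV[R]_m) : \bar R :=
  ereal_inf [set z | exists l u : nat -> 'rV[R]_m,
    [/\ (forall j i, l j ord0 i <= u j ord0 i),
        A `<=` \bigcup_j [set x | forall i, l j ord0 i <= x ord0 i <= u j ord0 i]
      & z = (\sum_(0 <= j <oo) (\prod_i (u j ord0 i - l j ord0 i))%:E)%E]].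

Definition ball_vol (m : nat) : R :=
  fine (lebesgue_outer (cballE (0 : 'rV[R]_m) 1)).

Context {n : nat}.
Implicit Types A S : set 'rV[R]_n.

(* The empty set has [diamE] equal to [-oo] and must have weight zero. *)
Definition hausdorff_weight (m : nat) S : \bar R :=
  if pselect (S = set0) then 0%E
  else ((ball_vol m / 2 ^+ m)%:E * diamE S ^+ m)%E.

Definition hausdorff_delta (m : nat) (delta : R) A : \bar R :=
  ereal_inf [set z | exists S : nat -> set 'rV[R]_n,
    [/\ (forall j, diamE (S j) <= delta%:E)%E,
        A `<=` \bigcup_j S j
      & z = (\sum_(0 <= j <oo) hausdorff_weight m (S j))%E]].

Definition hausdorff (m : nat) A : \bar R :=
  ereal_sup [set hausdorff_delta m delta A | delta in [set d : R | 0 < d]].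

End HausdorffMeasure.

Section Densities.
Context {R : realType} {n : nat}.
Implicit Types (phi : set 'rV[R]_n -> \bar R) (a v : 'rV[R]_n).

Definition meas_restr phi (S : set 'rV[R]_n) : set 'rV[R]_n -> \bar R :=
  fun X => phi (S `&` X).

Definition density_ratio (m : nat) phi a (r : R) : \bar R :=
  (phi (cballE a r) * ((ball_vol m * r ^+ m)^-1)%:E)%E.

Definition upper_density (m : nat) phi a : \bar R :=
  limf_esup (density_ratio m phi a) (0 : R)^'+.

Definition has_density (m : nat) phi a (d : \bar R) : Prop :=
  density_ratio m phi a r @[r --> (0 : R)^'+] --> d.

Definition cone_nbhd a v (eps : R) : set 'rV[R]_n :=
  [set x | exists r : R, 0 < r /\ enorm (r *: (x - a) - v) < eps].

Definition upper_aTan (m : nat) phi a : set 'rV[R]_n :=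
  [set v | forall eps : R, 0 < eps ->
     (0 < upper_density m (meas_restr phi (cone_nbhd a v eps)) a)%E].

Definition lower_aTan (m : nat) phi a : set 'rV[R]_n :=
  [set v | forall eps : R, 0 < eps -> exists eta : R, 0 < eta /\
     forall r : R, 0 < r <= eta ->
       ((eta * r ^+ m)%:E <= phi (oballE (a + r *: v) (eps * r)))%E].

(* the two cones coincide and the common set is [S] *)
Definition is_aTan (m : nat) phi a (S : set 'rV[R]_n) : Prop :=
  upper_aTan m phi a = S /\ lower_aTan m phi a = S.

End Densities.

Section TangentCones.
Context {R : realType} {n : nat}.
Implicit Types (B : set 'rV[R]_n) (a v : 'rV[R]_n).

Definition upper_Tan B a : set 'rV[R]_n :=
  [set v | limf_einf (fun r : R => (r^-1)%:E * edistE B (a + r *: v))%E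
             (0 : R)^'+ = 0%E].

Definition lower_Tan B a : set 'rV[R]_n :=
  [set v | ((r^-1)%:E * edistE B (a + r *: v))%E @[r --> (0 : R)^'+] --> 0%E].

Definition is_Tan B a (S : set 'rV[R]_n) : Prop :=
  upper_Tan B a = S /\ lower_Tan B a = S.

End TangentCones.

Section Smoothness.
Context {R : realType} {n : nat}.
Local Notation V := 'rV[R]_n.
Implicit Types (f : V -> V) (U : set V).

(* [iterdiff f [:: v_1; ...; v_i] x] is [D^i f (x) (v_1, ..., v_i)], where
   [D^i f = D (D^(i-1) f)]. *)
Fixpoint iterdiff f (vs : seq V) : V -> V :=
  match vs with
  | [::] => f
  | v :: vs' => fun x => 'd (iterdiff f vs') x v
  end.

Definition Diter (i : nat) f (x : V) : i.-tuple V -> V :=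
  fun vs => iterdiff f vs x.

(* Since [V] is finite dimensional, differentiability and continuity of
   [D^i f] are those of its evaluations at all [i]-tuples of vectors. *)
Definition class_C (k : nat) U f : Prop :=
  (forall vs x, (size vs < k)%N -> U x -> differentiable (iterdiff f vs) x) /\
  (forall vs x, size vs = k -> U x -> {for x, continuous (iterdiff f vs)}).

Definition locally_holder_D (k : nat) (alpha : R) U f : Prop :=
  forall x0, U x0 -> exists delta C : R, 0 < delta /\
    forall x y, U x -> U y -> oballE x0 delta x -> oballE x0 delta y ->
    forall vs : k.-tuple V,
      enorm (Diter f x vs - Diter f y vs) <=
        C * enorm (x - y) `^ alpha * \prod_(v <- vs) enorm v.

Definition class_Calpha (k : nat) (alpha : R) U f : Prop :=
  class_C k U f /\ (0 < alpha -> locally_holder_D k alpha U f).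

Definition submanifold (k : nat) (alpha : R) (mu : nat) (M : set V) : Prop :=
  forall x, M x -> exists (U W : set V) (phi psi : V -> V) (T : {vspace V}),
    [/\ open U /\ U x, open W, \dim T = mu,
        [/\ phi @` U = W, (forall y, U y -> psi (phi y) = y),
            class_Calpha k alpha U phi & class_Calpha k alpha W psi]
      & phi @` (M `&` U) = W `&` [set y | y \in T]].

End Smoothness.

Section ApproximateDifferentiability.
Context {R : realType} {n : nat}.
Local Notation V := 'rV[R]_n.
Implicit Types (A : set V) (a : V) (T : {vspace V}) (P : V -> V).

Definition off_graph T P (t r : R) A : set V :=
  A `&` cballE 0 r `&` [set z | (t%:E < edistE (gr T P) z)%E].

Definition ap_cond1 (m : nat) T A : Prop :=
  forall eps : R, 0 < eps -> exists rho eta : R, [/\ 0 < rho, 0 < eta &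
    forall r : R, 0 <= r <= rho -> forall z : V, z \in T -> cballE 0 r z ->
      ((eta * r ^+ m)%:E <=
         hausdorff m (cyl T z (eps * r) (eps * r) `&` A))%E].

Definition ap_cond2 (m k : nat) (alpha : R) T P A : Prop :=
  (forall eps : R, 0 < eps ->
     (hausdorff m (off_graph T P (eps * r ^+ k) r A)
        * ((ball_vol m * r ^+ m)^-1)%:E)%E @[r --> (0 : R)^'+] --> 0%E) /\
  (0 < alpha -> exists lambda : R, 0 <= lambda /\
     (hausdorff m (off_graph T P (lambda * r `^ (k%:R + alpha)) r A)
        * ((ball_vol m * r ^+ m)^-1)%:E)%E @[r --> (0 : R)^'+] --> 0%E).

Definition ap_diff_with (m k : nat) (alpha : R) T P A a : Prop :=
  let A1 := [set x - a | x in A] in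
  [/\ (1 <= m <= n)%N /\ \dim T = m,
      maps_to_orth T P /\ polyfun_on T k P,
      P 0 = 0 /\ is_diff (0 : V) (P \o orthproj T) (fun=> 0),
      ap_cond1 m T A1
    & ap_cond2 m k alpha T P A1].

Definition ap_diff (k : nat) (alpha : R) A a : Prop :=
  exists m T P, ap_diff_with m k alpha T P A a.

(* The default values of [xget] below are irrelevant where the notions are
   defined, and there the subspace, and the restriction of the polynomial to it,
   are unique. *)
Definition apTan A a : {vspace V} :=
  xget 0%VS [set T | exists m P, ap_diff_with m 1 0 T P A a].

Definition apPoly (i : nat) A a : V -> V :=
  xget (fun=> 0)
    [set P | ap_diff_with (\dim (apTan A a)) i 0 (apTan A a) P A a].

Definition apD (i : nat) A a : i.-tuple V -> V :=
  Diter (apPoly i A a \o orthproj (apTan A a)) 0.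

End ApproximateDifferentiability.

Arguments apD {R n} i A a _.

Section PointwiseDifferentiability.
Context {R : realType} {n : nat}.
Local Notation V := 'rV[R]_n.
Implicit Types (B M : set V) (a : V) (S : {vspace V}) (f : V -> V).

Definition pt_cond (k : nat) (alpha : R) M B a : Prop :=
  [/\ ((r^-1)%:E * ereal_sup [set `|edistE M x - edistE B x| | x in cballE a r])%E
        @[r --> (0 : R)^'+] --> 0%E,
      alpha = 0 ->
      ((r ^- k)%:E * ereal_sup [set edistE M x | x in cballE a r `&` B])%E
        @[r --> (0 : R)^'+] --> 0%E
    & 0 < alpha ->
      (limf_esup (fun r : R => (r `^ (- (k%:R + alpha)))%:E *
         ereal_sup [set edistE M x | x in cballE a r `&` B]) (0 : R)^'+ < +oo)%E].

Definition pt_diff (k : nat) (alpha : R) B a : Prop :=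
  exists (mu : nat) (M : set V),
    [/\ submanifold k alpha mu M, M a & pt_cond k alpha M B a].

(* [S] is meant to be [Tan(B, a)]; the chosen function has class [k] and the
   value of [ptD] for [i <= k] does not depend on the choice. *)
Definition pt_fun (k : nat) B a S : V -> V :=
  xget (fun=> 0)
    [set f | [/\ maps_to_orth S f, class_C k setT (f \o orthproj S),
                 gr S f a & pt_cond k 0 (gr S f) B a]].

Definition ptD (k i : nat) B a S : i.-tuple V -> V :=
  Diter (pt_fun k B a S \o orthproj S) a.

End PointwiseDifferentiability.

Arguments ptD {R n} k i B a S _.

(* Main.v *)
Require Import Defs.
From HB Require Import structures.
From mathcomp Require Import all_boot all_order all_algebra.
From mathcomp Require Import all_classical all_reals all_analysis.
From mathcomp Require Import ring lra.

(* Translate a to the origin, so that the approximate tangent plane T and the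
   polynomial P describe A near 0.  B keeps the points x of A whose distance
   from the graph M of P is at most h (2 |x|), where h is a nondecreasing gauge
   with h r = lambda r^(k + alpha) if alpha > 0 and h r = omega r * r^k with
   omega -> 0 if alpha = 0, chosen so that the part of A in B(0, r) farther than
   h r from M has measure o(r^m).  Summing this over dyadic annuli shows that
   A \ B has density 0, so the lower bounds of condition (1) survive in B.
   Hence B is within o(r) of M and conversely, which gives pointwise
   differentiability and both tangent cones.

   For the differentials, two graphs approximating B to order i have functions
   whose difference g is small at points that are only eps r-dense in T.
   By induction on j <= i, if the differentials of order < j of g vanish at 0
   then g is O(r^(j-1))-Lipschitz on B(0, r), so g is o(r^j) everywhere, and an
   iterated difference quotient shows that D^j g (0) = 0. *)

Set Implicit Arguments.
Unset Strict Implicit.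
Unset Printing Implicit Defensive.

Import Order.TTheory GRing.Theory Num.Theory.
Import numFieldNormedType.Exports.

Local Open Scope classical_set_scope.
Local Open Scope ring_scope.

(** * Euclidean geometry *)

(** The tangent plane and the two functions behind the differentials are arbitrary choices among all
    candidates. For the plane this forces a uniqueness proof in which planes of different dimensions
    have to be compared. For the differentials it forces a comparison between some function of class
    [C^k] and some polynomial, of which only the defining conditions are known. A point of [B] need
    not be close to the graph of that polynomial, but on each cylinder the exceptional part of [A]
    has too little measure to contain all of [B]. Polynomials are what make the approximating
    surface a submanifold of class [(k, alpha)] for every [alpha]: their [k]-th differentials are
    constant. *)

Section EuclideanNorm.
Context {R : realType} {n : nat}.
Local Notation V := 'rV[R]_n.
Implicit Types (x y z : V) (T : {vspace V}) (B : set V).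

Lemma dotvC x y : dotv x y = dotv y x.
Proof. by apply: eq_bigr => i _; rewrite mulrC. Qed.

Lemma dotvDl x y z : dotv (x + y) z = dotv x z + dotv y z.
Proof. by rewrite -big_split; apply: eq_bigr => i _; rewrite mxE mulrDl. Qed.

Lemma dotvZl (k : R) x y : dotv (k *: x) y = k * dotv x y.
Proof. by rewrite /dotv mulr_sumr; apply: eq_bigr => i _; rewrite mxE mulrA. Qed.

Lemma dotvDr x y z : dotv z (x + y) = dotv z x + dotv z y.
Proof. by rewrite dotvC dotvDl !(dotvC _ z). Qed.

Lemma dotvZr (k : R) x y : dotv x (k *: y) = k * dotv x y.
Proof. by rewrite dotvC dotvZl dotvC. Qed.

Lemma dotv_ge0 x : 0 <= dotv x x.
Proof. by apply: sumr_ge0 => i _; exact: sqr_ge0. Qed.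

Lemma enorm_ge0 x : 0 <= enorm x.
Proof. exact: sqrtr_ge0. Qed.

Lemma sqr_enorm x : enorm x ^+ 2 = dotv x x.
Proof. by rewrite sqr_sqrtr // dotv_ge0. Qed.

Lemma enorm0 : enorm (0 : V) = 0.
Proof.
by rewrite /enorm /dotv big1 ?sqrtr0 // => i _; rewrite mxE mul0r.
Qed.

Lemma enormZ (k : R) x : enorm (k *: x) = `|k| * enorm x.
Proof.
by rewrite /enorm dotvZl dotvZr mulrA -expr2 sqrtrM ?sqr_ge0 // sqrtr_sqr.
Qed.

Lemma enormN x : enorm (- x) = enorm x.
Proof. by rewrite -scaleN1r enormZ normrN1 mul1r. Qed.

Lemma enormBC x y : enorm (x - y) = enorm (y - x).
Proof. by rewrite -enormN opprB. Qed.

Lemma enorm_eq0 x : enorm x = 0 -> x = 0.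
Proof.
by move=> x0; apply: dotv_eq0; rewrite -sqr_enorm x0 expr0n.
Qed.

Lemma enorm_gt0 x : x != 0 -> 0 < enorm x.
Proof.
move=> x0; rewrite lt_neqAle enorm_ge0 andbT eq_sym.
by apply: contra x0 => /eqP/enorm_eq0 ->.
Qed.

Lemma cauchy_schwarz x y : dotv x y <= enorm x * enorm y.
Proof.
have [->|y0] := eqVneq y 0.
  by rewrite enorm0 mulr0 dotvC /dotv big1 // => i _; rewrite mxE mul0r.
have b0 : 0 < dotv y y by rewrite -sqr_enorm exprn_gt0 // enorm_gt0.
(* The squared length of [|y|^2 x - (x . y) y] is [|y|^2] times the Gram determinant of [x] and
   [y]. *)
have := dotv_ge0 (dotv y y *: x + (- dotv x y) *: y).
rewrite !(dotvDl, dotvDr, dotvZl, dotvZr) (dotvC y x).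
rewrite (_ : _ + _ = dotv y y * (dotv x x * dotv y y - dotv x y ^+ 2));
  last by ring.
rewrite pmulr_rge0 // subr_ge0 -!sqr_enorm -exprMn => H.
apply: le_trans (ler_norm _) _.
by rewrite -ler_sqr ?nnegrE ?mulr_ge0 ?enorm_ge0 // real_normK ?num_real.
Qed.

Lemma enormD x y : enorm (x + y) <= enorm x + enorm y.
Proof.
rewrite -ler_sqr ?nnegrE ?addr_ge0 ?enorm_ge0 //.
rewrite sqrrD !sqr_enorm !(dotvDl, dotvDr) (dotvC y x).
have := cauchy_schwarz x y; lra.
Qed.

Lemma enormB x y : enorm (x - y) <= enorm x + enorm y.
Proof. by rewrite -(enormN y); exact: enormD. Qed.

Lemma enormB_trans z x y : enorm (x - y) <= enorm (x - z) + enorm (z - y).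
Proof. by rewrite -[x in leLHS](subrK z) -addrA; exact: enormD. Qed.

Lemma le_enorm_add x y : enorm x <= enorm y + enorm (x - y).
Proof. by have := enormD y (x - y); rewrite addrC subrK. Qed.

Lemma coord_le_norm x (c : 'I_n) : `|x ord0 c| <= `|x|.
Proof.
rewrite /Num.norm/= mx_normrE.
exact: (le_bigmax _ (fun ij : 'I_1 * 'I_n => `|x ij.1 ij.2|) (ord0, c)).
Qed.

Lemma norm_le_coord x (e : R) : 0 <= e -> (forall c, `|x ord0 c| <= e) ->
  `|x| <= e.
Proof.
move=> e0 xe; rewrite {1}/Num.norm/= mx_normrE.
by apply/bigmax_leP; split => // -[i j] _ /=; rewrite ord1.
Qed.

Lemma norm_le_enorm x : `|x| <= enorm x.
Proof.
rewrite {1}/Num.norm/= mx_normrE; apply/bigmax_leP.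
split=> [|-[i j] _ /=]; first exact: enorm_ge0.
rewrite ord1 -ler_sqr ?nnegrE ?enorm_ge0 // real_normK ?num_real // sqr_enorm.
by rewrite /dotv (bigD1 j) //= expr2 lerDl sumr_ge0 // => k _; exact: sqr_ge0.
Qed.

(** The crude factor [n + 1] is positive in every dimension, so it can be divided by. *)
Lemma enorm_le_norm x : enorm x <= n.+1%:R * `|x|.
Proof.
rewrite -ler_sqr ?nnegrE ?enorm_ge0 ?mulr_ge0 // sqr_enorm exprMn.
apply: (@le_trans _ _ (n%:R * `|x| ^+ 2)).
  rewrite /dotv -[n in n%:R]card_ord mulr_natl -sumr_const.
  apply: ler_sum => i _; rewrite -expr2 -real_normK ?num_real //.
  rewrite ler_sqr ?nnegrE // {2}/Num.norm/= mx_normrE.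
  exact: (le_bigmax _ (fun ij : 'I_1 * 'I_n => `|x ij.1 ij.2|) (ord0, i)).
rewrite ler_wpM2r ?exprn_ge0 // -natrX ler_nat.
by apply: leq_trans (leq_pexp2l (m := n.+1) (n1 := 1) _ _).
Qed.

End EuclideanNorm.

Section OrthogonalProjection.
Context {R : realType} {n : nat}.
Local Notation V := 'rV[R]_n.
Implicit Types (x y z : V) (T : {vspace V}).

Lemma orthprojD T x y : orthproj T (x + y) = orthproj T x + orthproj T y.
Proof. exact: linearD. Qed.

Lemma orthprojB T x y : orthproj T (x - y) = orthproj T x - orthproj T y.
Proof. exact: linearB. Qed.

Lemma orthprojZ T (k : R) x : orthproj T (k *: x) = k *: orthproj T x.
Proof. exact: linearZ. Qed.

Lemma orthproj_sum T I (s : seq I) (p : pred I) (F : I -> V) :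
  orthproj T (\sum_(i <- s | p i) F i) = \sum_(i <- s | p i) orthproj T (F i).
Proof. exact: linear_sum. Qed.

Lemma orthproj0 T : orthproj T 0 = 0.
Proof. exact: linear0. Qed.

Lemma orthproj_id T x : x \in T -> orthproj T x = x.
Proof. by apply: daddv_pi_id; exact: capv_orthv. Qed.

(** Both [x] and [x - orthproj T x] are orthogonal to [orthproj T x], so the latter is orthogonal to
    itself. *)
Lemma orthproj_orth T x : x \in orthv T -> orthproj T x = 0.
Proof.
move=> xo; apply: dotv_eq0.
have /mem_orthv E := sub_orthproj_mem T x.
have /mem_orthv E' := xo.
have := E _ (orthproj_mem T x); rewrite dotvDr E' ?orthproj_mem // add0r.
by rewrite -scaleN1r dotvZr mulN1r => /eqP; rewrite oppr_eq0 => /eqP.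
Qed.

Lemma orthproj_orthv T x : orthproj (orthv T) x = x - orthproj T x.
Proof.
rewrite -[x in LHS](subrK (orthproj T x)) orthprojD.
rewrite orthproj_id ?sub_orthproj_mem //.
rewrite (@orthproj_orth (orthv T)) ?addr0 //.
by apply/mem_orthv => y /mem_orthv E; rewrite dotvC E // orthproj_mem.
Qed.

Lemma orthproj_graph T x w : x \in T -> w \in orthv T ->
  orthproj T (x + w) = x.
Proof. by move=> xT wT; rewrite orthprojD orthproj_id // orthproj_orth ?addr0. Qed.

Lemma orthprojv_graph T x w : x \in T -> w \in orthv T ->
  orthproj (orthv T) (x + w) = w.
Proof.
by move=> xT wT; rewrite orthproj_orthv orthproj_graph // addrC addKr.
Qed.

Lemma sqr_enorm_orthproj T x :
  enorm x ^+ 2 = enorm (orthproj T x) ^+ 2 + enorm (orthproj (orthv T) x) ^+ 2.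
Proof.
have pyth (p q : V) : dotv p q = 0 ->
    enorm (p + q) ^+ 2 = enorm p ^+ 2 + enorm q ^+ 2.
  by move=> E; rewrite !sqr_enorm dotvDl !dotvDr (dotvC q p) E addr0 add0r.
rewrite orthproj_orthv -pyth; first by rewrite addrC subrK.
by have /mem_orthv := sub_orthproj_mem T x; apply; exact: orthproj_mem.
Qed.

Lemma enorm_orthproj T x : enorm (orthproj T x) <= enorm x.
Proof.
rewrite -ler_sqr ?nnegrE ?enorm_ge0 // (sqr_enorm_orthproj T x) lerDl.
exact: sqr_ge0.
Qed.

Lemma orthprojv_eq0 T x : orthproj (orthv T) x = 0 -> x \in T.
Proof.
by rewrite orthproj_orthv => /eqP; rewrite subr_eq0 => /eqP ->; exact: orthproj_mem.
Qed.

Lemma enorm_split T x :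
  enorm x <= enorm (orthproj T x) + enorm (orthproj (orthv T) x).
Proof.
rewrite -[x in leLHS](subrK (orthproj T x)) -orthproj_orthv addrC.
exact: enormD.
Qed.

End OrthogonalProjection.

Section EuclideanDistance.
Context {R : realType} {n : nat}.
Local Notation V := 'rV[R]_n.
Implicit Types (x y z b : V) (B : set V).

Lemma edistE_ge0 B x : (0 <= edistE B x)%E.
Proof. by apply: le_ereal_inf_tmp => _ [b _ <-]; rewrite lee_fin enorm_ge0. Qed.

Lemma edistE_le B x b : B b -> (edistE B x <= (enorm (x - b))%:E)%E.
Proof. by move=> Bb; apply: ereal_inf_lbound; exists b. Qed.

Lemma edistE_lt B x (t : R) : (edistE B x < t%:E)%E ->
  exists2 b, B b & enorm (x - b) < t.
Proof. by move=> /ereal_inf_lt[_ [b Bb <-]]; rewrite lte_fin; exists b. Qed.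

Lemma edistE_fin_num B x b : B b -> edistE B x \is a fin_num.
Proof.
move=> /(edistE_le x) xb; rewrite ge0_fin_numE ?edistE_ge0 //.
by apply: le_lt_trans xb _; rewrite ltry.
Qed.

Lemma edistE_triangle B x y :
  (edistE B x <= edistE B y + (enorm (x - y))%:E)%E.
Proof.
rewrite -leeBlDr //; apply: le_ereal_inf_tmp => _ [b Bb <-].
rewrite leeBlDr // -EFinD; apply: le_trans (edistE_le x Bb) _.
by rewrite lee_fin [leRHS]addrC; exact: enormB_trans.
Qed.

Lemma edistE_shift B x a : edistE [set a + b | b in B] x = edistE B (x - a).
Proof.
rewrite /edistE; congr (ereal_inf _); apply/seteqP; split=> _ [b Bb <-].
  by case: Bb => c Bc <-; exists c => //; rewrite opprD addrA.
by exists (a + b); [exists b|rewrite opprD addrA].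
Qed.

End EuclideanDistance.

(** * Hausdorff measure *)

Section HausdorffOuter.
Context {R : realType} {n : nat}.
Local Notation V := 'rV[R]_n.
Local Open Scope ereal_scope.
Implicit Types (A S : set V) (a : V).

Lemma ball_vol_ge0 m : (0 <= ball_vol m :> R)%R.
Proof.
apply: fine_ge0; apply: le_ereal_inf_tmp => _ [l [u [lu _ ->]]].
apply: nneseries_ge0 => j _ _; rewrite lee_fin.
by apply: prodr_ge0 => i _; rewrite subr_ge0.
Qed.

Lemma diamE_ge0 S x : S x -> 0 <= diamE S.
Proof.
move=> Sx; apply: ereal_sup_ubound; exists x, x; split => //.
by rewrite subrr enorm0.
Qed.

Lemma hausdorff_weight_ge0 m S : 0 <= hausdorff_weight m S.
Proof.
rewrite /hausdorff_weight; case: pselect => [S0|S0] /=; first by [].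
have /eqP/set0P[x Sx] := S0.
apply: mule_ge0; first by rewrite lee_fin divr_ge0 ?ball_vol_ge0 ?exprn_ge0.
by apply: expe_ge0; exact: diamE_ge0 Sx.
Qed.

Lemma hausdorff_weight0 m : hausdorff_weight m (set0 : set V) = 0.
Proof. by rewrite /hausdorff_weight; case: pselect. Qed.

Lemma diamE_le A S : A `<=` S -> diamE A <= diamE S.
Proof.
move=> AS; apply: ereal_sup_le => _ [x [y [Ax Ay ->]]].
by exists x, y; split => //; exact: AS.
Qed.

Lemma diamE_shift a S : diamE [set (a + x)%R | x in S] = diamE S.
Proof.
rewrite /diamE; congr ereal_sup; apply/seteqP; split=> _ [x [y [Sx Sy ->]]].
  case: Sx Sy => x' Sx' <- [y' Sy' <-]; exists x', y'; split => //.
  by congr (_%:E); congr enorm; rewrite opprD addrACA subrr add0r.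
exists (a + x)%R, (a + y)%R; split; [by exists x|by exists y|].
by congr (_%:E); congr enorm; rewrite opprD addrACA subrr add0r.
Qed.

Lemma hausdorff_weight_shift m a S :
  hausdorff_weight m [set (a + x)%R | x in S] = hausdorff_weight m S.
Proof.
rewrite /hausdorff_weight diamE_shift.
case: pselect => [aS0|aS0]; case: pselect => [S0|S0] //.
  have /eqP/set0P[x Sx] := S0.
  by exfalso; suff: set0 (a + x)%R by []; rewrite -aS0; exists x.
by exfalso; apply: aS0; rewrite S0 image_set0.
Qed.

(* The sets of diameter at most [delta] form a semiring of sets, for which
   [hausdorff_delta] is the outer measure extending [hausdorff_weight]. *)
Definition small_diam (delta : R) : Type := V.

End HausdorffOuter.

Section SmallDiam.
Context {R : realType} {n : nat} (delta : R).
Local Notation V := 'rV[R]_n.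
Local Notation T := (@small_diam R n delta).

HB.instance Definition _ := Pointed.copy T V.

Let small : set (set T) := [set S | (diamE (S : set V) <= delta%:E)%E].

Let small0 : small set0.
Proof.
rewrite /small/= /diamE (_ : [set _ | _] = set0) ?ereal_sup0 ?leNye //.
by apply/seteqP; split=> z []; move=> x [y] [].
Qed.

Let smallI : setI_closed small.
Proof.
move=> A B As _; apply: le_trans As; apply: diamE_le; exact: subIsetl.
Qed.

Let smallD : semi_setD_closed small.
Proof.
move=> A B As _; exists [set A `\` B]; split.
- exact: finite_set1.
- move=> _ ->; apply: le_trans As; apply: diamE_le; exact: subDsetl.
- by rewrite bigcup_set1.
- by move=> X Y -> ->.
Qed.

HB.instance Definition _ :=
  @isSemiRingOfSets.Build default_measure_display T small small0 smallI smallD.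

Lemma hausdorff_deltaE m (A : set V) :
  hausdorff_delta m delta A =
  @mu_ext _ T R (hausdorff_weight m : set V -> \bar R) A.
Proof.
rewrite /hausdorff_delta /mu_ext; congr ereal_inf; apply/seteqP; split.
  by move=> _ [S [Sd AS ->]]; exists S.
by move=> _ [S [Sd AS] <-]; exists S.
Qed.

(** This holds for the outer extension of any nonnegative weight, additive or not. *)
Lemma hausdorff_delta_bigcup m (F : nat -> set V) :
  (hausdorff_delta m delta (\bigcup_j F j) <=
     \sum_(0 <= j <oo) hausdorff_delta m delta (F j))%E.
Proof.
rewrite hausdorff_deltaE; under eq_eseriesr do rewrite hausdorff_deltaE.
exact: (@mu_ext_sigma_subadditive _ T R (hausdorff_weight m : set V -> \bar R)
  (hausdorff_weight_ge0 m) F).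
Qed.

End SmallDiam.

Section HausdorffMeasureTheory.
Context {R : realType} {n : nat}.
Local Notation V := 'rV[R]_n.
Local Open Scope ereal_scope.
Implicit Types (A B S : set V) (a : V) (m : nat).

Lemma hausdorff_delta_ge0 m (d : R) A : 0 <= hausdorff_delta m d A.
Proof. by rewrite hausdorff_deltaE mu_ext_ge0 //; exact: hausdorff_weight_ge0. Qed.

Lemma hausdorff_delta_anti m (d d' : R) A : (d <= d')%R ->
  hausdorff_delta m d' A <= hausdorff_delta m d A.
Proof.
move=> dd'; apply: ereal_inf_le_tmp => _ [S [Sd AS ->]]; exists S; split => //.
by move=> j; apply: le_trans (Sd j) _; rewrite lee_fin.
Qed.

Lemma hausdorff_delta_le m (d : R) A : (0 < d)%R ->
  hausdorff_delta m d A <= hausdorff m A.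
Proof. by move=> d0; apply: ereal_sup_ubound; exists d. Qed.

Lemma hausdorff_ge0 m A : 0 <= hausdorff m A.
Proof.
exact: le_trans (hausdorff_delta_ge0 m 1 A) (hausdorff_delta_le m A ltr01).
Qed.

Lemma hausdorff0 m : hausdorff m (set0 : set V) = 0.
Proof.
apply/eqP; rewrite eq_le hausdorff_ge0 andbT.
apply: ge_ereal_sup => _ [d _ <-]; rewrite hausdorff_deltaE mu_ext0 //.
- exact: hausdorff_weight0.
- exact: hausdorff_weight_ge0.
Qed.

Lemma le_hausdorff m A B : A `<=` B -> hausdorff m A <= hausdorff m B.
Proof.
move=> AB; apply: ge_ereal_sup => _ [d d0 <-].
apply: le_trans (hausdorff_delta_le m B d0); rewrite !hausdorff_deltaE.
exact: le_mu_ext.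
Qed.

Lemma hausdorff_bigcup m (F : nat -> set V) :
  hausdorff m (\bigcup_j F j) <= \sum_(0 <= j <oo) hausdorff m (F j).
Proof.
apply: ge_ereal_sup => _ [d d0 <-].
apply: le_trans (hausdorff_delta_bigcup d m F) _; apply: lee_nneseries.
  by move=> j _ _; exact: hausdorff_delta_ge0.
by move=> j _; exact: hausdorff_delta_le.
Qed.

Lemma hausdorffU m A B : hausdorff m (A `|` B) <= hausdorff m A + hausdorff m B.
Proof.
pose F j := if j is 0%N then A else if j is 1%N then B else set0.
have -> : A `|` B = \bigcup_j F j.
  apply/seteqP; split=> [x [Ax|Bx]|x [[|[|j]] _ //=]]; last 2 first.
  - by left.
  - by right.
  - by exists 0%N.
  - by exists 1%N.
apply: le_trans (hausdorff_bigcup m F) _.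
rewrite (nneseries_split 0 2); last by move=> j _; exact: hausdorff_ge0.
rewrite eseries0 ?adde0; last first.
  by move=> [|[|j]] // _ _; exact: hausdorff0.
by rewrite add0n !big_nat_recl // big_geq // adde0.
Qed.

Lemma hausdorff_shift m a A : hausdorff m [set (a + x)%R | x in A] = hausdorff m A.
Proof.
have H b B : hausdorff m [set (b + x)%R | x in B] <= hausdorff m B.
  apply: ge_ereal_sup => _ [d d0 <-].
  apply: le_trans (hausdorff_delta_le m B d0).
  apply: le_ereal_inf_tmp => _ [S [Sd BS ->]]; apply: ereal_inf_lbound.
  exists (fun j => [set (b + x)%R | x in S j]); split.
  - by move=> j; rewrite diamE_shift.
  - move=> _ [x /BS[j _ Sx] <-]; exists j => //; by exists x.
  - by apply: eq_eseriesr => j _; rewrite hausdorff_weight_shift.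
(* The converse inequality is the same bound for the translation by [- a]. *)
apply/eqP; rewrite eq_le H /=.
rewrite [X in hausdorff m X <= _](_ : A =
  [set (- a + x)%R | x in [set (a + x)%R | x in A]]) ?H //.
rewrite image_comp; apply/seteqP; split=> [x Ax|_ [x Ax <-]/=].
  by exists x => //=; rewrite addKr.
by rewrite addKr.
Qed.

Lemma hausdorff_weight_dim m m' (d : R) S : (m' <= m)%N ->
  (0 < ball_vol m' :> R)%R -> diamE S <= d%:E ->
  hausdorff_weight m S <=
    (ball_vol m / 2 ^+ m * (2 ^+ m' / ball_vol m') * d ^+ (m - m'))%:E *
    hausdorff_weight m' S.
Proof.
move=> m'm bv Sd; rewrite /hausdorff_weight; case: pselect => [S0|S0] /=; first by rewrite mule0.
have /eqP/set0P[x Sx] := S0.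
have D0 := diamE_ge0 Sx.
case: (diamE S) D0 Sd => [s| |] //; rewrite !lee_fin => s0 sd.
rewrite -!EFin_expe -!EFinM lee_fin.
have -> : (s ^+ m = s ^+ (m - m') * s ^+ m')%R by rewrite -exprD subnK.
have -> : (ball_vol m / 2 ^+ m * (2 ^+ m' / ball_vol m') * d ^+ (m - m') *
     (ball_vol m' / 2 ^+ m' * s ^+ m'))%R =
  (ball_vol m / 2 ^+ m * (d ^+ (m - m') * s ^+ m') :> R)%R.
  by field; rewrite !expf_neq0 ?pnatr_eq0 //= gt_eqF.
rewrite ler_wpM2l ?divr_ge0 ?ball_vol_ge0 ?exprn_ge0 //.
rewrite ler_wpM2r ?exprn_ge0 // lerXn2r ?nnegrE //.
exact: le_trans sd.
Qed.

(** On sets of diameter at most [d] the [m]-weight is at most a constant times [d^(m - m')] times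
    the [m']-weight, and [d] is arbitrarily small. This is what separates tangent planes of
    different dimensions. *)
Lemma hausdorff_dim_eq0 m m' A : (m' < m)%N -> (0 < ball_vol m' :> R)%R ->
  hausdorff m' A < +oo -> hausdorff m A = 0.
Proof.
move=> m'm bv Aoo; apply/eqP; rewrite eq_le hausdorff_ge0 andbT.
apply: ge_ereal_sup => _ [d0 /= d00 <-].
apply/lee_addgt0Pr => e e0; rewrite add0e.
set c := (ball_vol m / 2 ^+ m * (2 ^+ m' / ball_vol m') :> R)%R.
have c0 : (0 <= c)%R.
  by rewrite mulr_ge0 ?divr_ge0 ?ball_vol_ge0 ?exprn_ge0.
have [h hE h0] : exists2 h : R, hausdorff m' A = h%:E & (0 <= h)%R.
  have := hausdorff_ge0 m' A; case: (hausdorff m' A) Aoo => // h _; by exists h.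
(* [d <= 1] reduces [d^(m - m')] to [d]; the last bound makes [c (h + 1) d <= e], its summand 1
   keeping the denominator positive. *)
pose d := Num.min d0 (Num.min 1%R (e / (c * (h + 1) + 1))%R).
have ch : (0 < c * (h + 1) + 1)%R by rewrite ltr_wpDl // mulr_ge0 // addr_ge0.
have d_gt0 : (0 < d)%R by rewrite !lt_min d00 ltr01 divr_gt0.
apply: le_trans (hausdorff_delta_anti m A (_ : (d <= d0)%R)) _.
  by rewrite ge_min lexx.
have K0 : (0 <= c * d ^+ (m - m'))%R by rewrite mulr_ge0 // exprn_ge0 // ltW.
have /ereal_inf_lt[_ [S [Sd AS ->]] Sh] : hausdorff_delta m' d A < (h + 1)%:E.
  apply: le_lt_trans (hausdorff_delta_le m' A d_gt0) _.
  by rewrite hE lte_fin ltrDl.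
apply: (@le_trans _ _ (\sum_(0 <= j <oo) hausdorff_weight m (S j))).
  by apply: ereal_inf_lbound; exists S.
apply: (@le_trans _ _ ((c * d ^+ (m - m'))%:E * (h + 1)%:E)); last first.
  rewrite -EFinM lee_fin.
  apply: (@le_trans _ _ (c * (h + 1) * d)%R).
    rewrite mulrAC ler_wpM2l ?(mulr_ge0 c0) ?addr_ge0 //.
    apply: (@le_trans _ _ (d ^+ 1)%R); last by rewrite expr1.
    apply: ler_wiXn2l; first exact: ltW.
      by rewrite !ge_min lexx orbT.
    by rewrite subn_gt0.
  have : (d <= e / (c * (h + 1) + 1))%R by rewrite !ge_min lexx !orbT.
  rewrite ler_pdivlMr // => /(le_trans _); apply.
  by rewrite mulrC ler_wpM2l ?(ltW d_gt0) // lerDl.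
apply: le_trans (lee_wpmul2l (_ : 0 <= (c * d ^+ (m - m'))%:E) (ltW Sh)).
  rewrite -nneseriesZl //; last by move=> j _; exact: hausdorff_weight_ge0.
  apply: lee_nneseries => [j _ _|j _]; first exact: hausdorff_weight_ge0.
  by apply: hausdorff_weight_dim => //; exact: ltnW.
by rewrite lee_fin.
Qed.

(** Half-open cubes of side [d / (n + 1)], indexed by integer vectors through [unpickle]; the factor
    [n + 1] passes from the maximum norm to the Euclidean one. *)
Lemma small_cover (d : R) : (0 < d)%R -> exists S : nat -> set V,
  (forall j, diamE (S j) <= d%:E) /\ [set: V] `<=` \bigcup_j S j.
Proof.
move=> d0; pose e := (d / n.+1%:R)%R.
have e0 : (0 < e)%R by rewrite divr_gt0.
pose cell (z : 'rV[int]_n) := [set x : V | forall i, Num.floor (x ord0 i / e) = z ord0 i].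
exists (fun j => if unpickle j is Some z then cell z else set0); split=> [j|x _].
  apply: ge_ereal_sup => _ [x [y [Sx Sy ->]]].
  case: (unpickle j) Sx Sy => [z Sx Sy|//].
  rewrite lee_fin; apply: le_trans (enorm_le_norm _) _.
  rewrite mulrC -ler_pdivlMr // -/e; apply: norm_le_coord (ltW e0) _ => c.
  rewrite !mxE; have := Sx c; have := Sy c.
  set u := x ord0 c; set v := y ord0 c => fv fu.
  have /andP[u1 u2] := floor_itv (u / e)%R.
  have /andP[v1 v2] := floor_itv (v / e)%R.
  rewrite -[(u - v)%R](divfK (lt0r_neq0 e0)) normrM (gtr0_norm e0).
  rewrite ger_pMl // mulrBl ler_norml.
  move: u1 u2 v1 v2; rewrite fu fv intrD; lra.
exists (pickle (\row_i Num.floor (x ord0 i / e) : 'rV[int]_n)) => //=.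
by rewrite pickleK => i; rewrite mxE.
Qed.

(** If [ball_vol m] were 0, all weights would vanish, while every set has countable covers by small
    sets. Condition (1) provides a set of positive measure, so the volume of the unit ball never has
    to be computed. *)
Lemma ball_vol_gt0 m A : 0 < hausdorff m A -> (0 < ball_vol m :> R)%R.
Proof.
move=> A0; rewrite lt_neqAle ball_vol_ge0 andbT eq_sym; apply/eqP => bv0.
move: A0; apply/negP; rewrite -leNgt.
apply: ge_ereal_sup => _ [d /= d0 <-].
have [S [Sd VS]] := small_cover d0.
apply: ge_ereal_inf; exists (\sum_(0 <= j <oo) hausdorff_weight m (S j)).
  by exists S; split => //; apply: subset_trans VS.
rewrite eseries0 // => j _ _; rewrite /hausdorff_weight bv0 mul0r mul0e.
by case: pselect.
Qed.

End HausdorffMeasureTheory.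

(** * Limits at 0 from the right *)

Section RightLimits.
Context {R : realType}.
Implicit Types (f : R -> \bar R) (P : R -> Prop).

Lemma at_rightP P : (\forall r \near (0 : R)^'+, P r) <->
  exists2 d : R, 0 < d & forall r, 0 < r -> r < d -> P r.
Proof.
split=> [/nbhs_ballP[d /= d0 H]|[d d0 H]].
  exists d => // r r0 rd; apply: H => //.
  by rewrite /ball/= sub0r normrN gtr0_norm.
apply/nbhs_ballP; exists d => //= r; rewrite /ball/= sub0r normrN => rd r0.
by apply: H => //; apply: le_lt_trans rd; exact: ler_norm.
Qed.

Lemma near_right_lt (d : R) : 0 < d -> \forall r \near (0 : R)^'+, r < d.
Proof. by move=> d0; apply/at_rightP; exists d. Qed.

Lemma near_right_gt0 : \forall r \near (0 : R)^'+, 0 < r.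
Proof. by apply/at_rightP; exists 1. Qed.

Lemma near_rightM (c : R) P : 0 < c -> (\forall r \near (0 : R)^'+, P r) ->
  \forall r \near (0 : R)^'+, P (c * r).
Proof.
move=> c0 /at_rightP[d d0 H]; apply/at_rightP; exists (d / c).
  exact: divr_gt0.
move=> r r0 rd; apply: H; first exact: mulr_gt0.
by rewrite mulrC -ltr_pdivlMr.
Qed.

Lemma cvg_right f (l : R) :
  (forall e : R, 0 < e -> \forall r \near (0 : R)^'+,
     ((l - e)%:E <= f r <= (l + e)%:E)%E) ->
  f r @[r --> (0 : R)^'+] --> l%:E.
Proof.
move=> H U lU.
have /nbhs_ballP[e /= e0 eU] : nbhs l (fun x => U x%:E) by exact: lU.
apply: filterS (H _ (divr_gt0 e0 (ltr0Sn R 1))) => r.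
rewrite -[X in _ -> X]/(U (f r)).
case: (f r) => [s| |]; rewrite ?lee_fin ?leNye ?leye_eq ?andbF // => /andP[h1 h2].
apply: eU; rewrite /ball/= ltr_norml; lra.
Qed.

Lemma cvg_right_inv f (l e : R) : f r @[r --> (0 : R)^'+] --> l%:E -> 0 < e ->
  \forall r \near (0 : R)^'+, (f r < (l + e)%:E)%E.
Proof.
move=> fl e0; apply: (fl [set x | (x < (l + e)%:E)%E]).
suff : nbhs l (fun x => (x%:E < (l + e)%:E)%E) by exact: id.
apply/nbhs_ballP; exists e => //= x; rewrite /ball/= lte_fin ltr_norml => h.
lra.
Qed.

Lemma limf_einf_right f (l : R) :
  (forall e : R, 0 < e -> \forall r \near (0 : R)^'+,
     ((l - e)%:E <= f r <= (l + e)%:E)%E) ->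
  limf_einf f (0 : R)^'+ = l%:E.
Proof.
move=> H; rewrite limf_einfE; apply/eqP; rewrite eq_le; apply/andP; split.
  apply: ge_ereal_sup => _ [V FV <-]; apply/lee_addgt0Pr => e e0.
  have [r [Vr /andP[_ fr]]] := filter_ex (filterI FV (H e e0)).
  by apply: ge_ereal_inf; exists (f r) => //; exists r.
apply/lee_subgt0Pr => e e0; rewrite -EFinB.
apply: le_ereal_sup_tmp.
exists (ereal_inf [set f x | x in [set r | ((l - e)%:E <= f r <= (l + e)%:E)%E]]).
  by exists [set r | ((l - e)%:E <= f r <= (l + e)%:E)%E] => //; exact: H.
by apply: le_ereal_inf_tmp => _ [r /andP[]? _ <-].
Qed.

Lemma limf_esup_right_le f (c : R) :
  (\forall r \near (0 : R)^'+, (f r <= c%:E)%E) ->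
  (limf_esup f (0 : R)^'+ <= c%:E)%E.
Proof.
move=> H; rewrite limf_esupE; apply: ge_ereal_inf.
exists (ereal_sup [set f x | x in [set r | (f r <= c%:E)%E]]).
  by exists [set r | (f r <= c%:E)%E].
by apply: ge_ereal_sup => _ [r /= fr <-].
Qed.

Lemma limf_esup_right_ge f (c : R) :
  (\forall r \near (0 : R)^'+, (c%:E <= f r)%E) ->
  (c%:E <= limf_esup f (0 : R)^'+)%E.
Proof.
move=> H; rewrite limf_esupE; apply: le_ereal_inf_tmp => _ [V FV <-].
have [r [Vr fr]] := filter_ex (filterI FV H).
by apply: le_ereal_sup_tmp; exists (f r) => //; exists r.
Qed.

(** [f r = o(r^m)] as an inequality, which can be summed and rescaled without the normalising factor
    [ball_vol m]. *)
Definition right_littleo (m : nat) f : Prop :=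
  forall e : R, 0 < e -> \forall r \near (0 : R)^'+, (f r <= (e * r ^+ m)%:E)%E.

Lemma density_cvg0P (m : nat) f (v : R) : 0 < v -> (forall r, 0 <= f r)%E ->
  (f r * ((v * r ^+ m)^-1)%:E)%E @[r --> (0 : R)^'+] --> 0%E <->
  right_littleo m f.
Proof.
move=> v0 f0; split=> [fl e e0|fo].
  have := cvg_right_inv fl (mulr_gt0 e0 (_ : 0 < v^-1)).
  rewrite invr_gt0 => /(_ v0); rewrite add0r => H.
  near=> r; have r0 : 0 < r by near: r; exact: near_right_gt0.
  have vr : 0 < v * r ^+ m by rewrite mulr_gt0 // exprn_gt0.
  have : (f r * ((v * r ^+ m)^-1)%:E < (e / v)%:E)%E by near: r.
  rewrite lte_pdivrMr // -EFinM => /ltW.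
  by rewrite (_ : e / v * _ = e * r ^+ m) //; field; rewrite gt_eqF.
apply: cvg_right => e e0; near=> r.
have r0 : 0 < r by near: r; exact: near_right_gt0.
have vr : 0 < v * r ^+ m by rewrite mulr_gt0 // exprn_gt0.
rewrite !add0r; apply/andP; split.
  apply: (@le_trans _ _ 0%E); first by rewrite lee_fin oppr_le0 ltW.
  by apply: mule_ge0 => //; rewrite lee_fin invr_ge0 ltW.
rewrite lee_pdivrMr // -EFinM mulrA.
by near: r; apply: fo; exact: mulr_gt0.
Unshelve. all: by end_near. Qed.

End RightLimits.

(** * Vanishing of iterated differentials *)

Section Calculus.
Context {R : realType} {n : nat}.
Local Notation V := 'rV[R]_n.
Implicit Types (F g : V -> V) (x y v : V) (vs : seq V).

Lemma rowE_delta x : x = \sum_i x ord0 i *: delta_mx ord0 i.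
Proof.
by rewrite {1}(matrix_sum_delta x) big_ord1.
Qed.

Lemma linear_differentiable_rV (W : normedModType R) (f : {linear V -> W}) x :
  differentiable f x.
Proof.
have -> : f = \sum_i (fun y : V => y ord0 i *: f (delta_mx ord0 i)) :> (V -> W).
  apply/funext => y; rewrite {1}(rowE_delta y) linear_sum fct_sumE.
  by apply: eq_bigr => i _; rewrite linearZ.
apply: differentiable_sum => i; apply: differentiableZl.
exact: differentiable_coord.
Qed.

Lemma diff_linear_rV (W : normedModType R) (f : {linear V -> W}) x :
  'd f x = f :> (V -> W).
Proof.
apply: diff_lin => y; apply: differentiable_continuous.
exact: linear_differentiable_rV.
Qed.

Lemma is_diff_linear_rV (W : normedModType R) (f : {linear V -> W}) x :
  is_diff x f f.
Proof.
by apply: DiffDef; [exact: linear_differentiable_rV | exact: diff_linear_rV].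
Qed.

Lemma diff_rowE F x v :
  'd F x v = \sum_i v ord0 i *: 'd F x (delta_mx ord0 i).
Proof.
rewrite {1}(rowE_delta v) linear_sum; apply: eq_bigr => i _.
exact: linearZ.
Qed.

(** The mean value theorem fails for vector-valued maps, so it is stated for one coordinate; the
    intermediate point depends on [c]. *)
Lemma mvt_coord F x v (c : 'I_n) : (forall y, differentiable F y) ->
  exists t : R, 0 <= t <= 1 /\
    F (x + v) ord0 c - F x ord0 c = ('d F (x + t *: v) v) ord0 c.
Proof.
move=> dF.
pose line (t : R) : V := t *: v + x.
pose co (N : V) : R := N ord0 c.
have co_lin : linear co by move=> k u w; rewrite /co !mxE.
pose coL : {linear V -> R} := HB.pack co (GRing.isLinear.Build _ _ _ _ _ co_lin).
pose phi : R -> R := coL \o (F \o line).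
have dline (t : R) : is_diff t line ( *:%R ^~ v).
  by apply: is_diff_eq; rewrite addr0.
have dphi (t : R) : is_diff t phi (coL \o ('d F (line t) \o ( *:%R ^~ v))).
  apply: is_diff_comp; last exact: is_diff_linear_rV.
  apply: is_diff_comp; exact: differentiableP.
have Dphi (t : R) : is_derive t (1 : R) phi (('d F (x + t *: v) v) ord0 c).
  have dt : differentiable phi t by case: (dphi t).
  apply: DeriveDef; first exact/diff_derivable.
  rewrite deriveE // diff_val /= scale1r /co/= /line.
  by rewrite (addrC x).
have [|t t01] := @MVT_segment R phi _ 0 1 ler01 (fun t _ => Dphi t).
  apply: continuous_subspaceT => t; apply: differentiable_continuous.
  by case: (dphi t).
rewrite subr0 mulr1 => E; exists t; split.
  by move: t01; rewrite in_itv.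
by rewrite -E /phi/= /co /line !scale1r !scale0r add0r (addrC v).
Qed.

Lemma class_C_le k l U g : (l <= k)%N -> class_C k U g -> class_C l U g.
Proof.
move=> lk [dg cg]; split=> [vs x vl Ux|vs x vl Ux].
  by apply: dg => //; exact: leq_trans lk.
move: lk; rewrite leq_eqVlt => /orP[/eqP lk|lk].
  by apply: cg => //; rewrite vl.
by apply: differentiable_continuous; apply: dg => //; rewrite vl.
Qed.

Lemma iterdiff_shift k g b vs : class_C k setT g -> (size vs <= k)%N ->
  iterdiff (fun x => g (x + b)) vs = fun x => iterdiff g vs (x + b).
Proof.
move=> Cg; elim: vs => [|v vs IH vk]; first by move=> _; exact: erefl.
have dg x : differentiable (iterdiff g vs) x by apply: Cg.1.
apply/funext => x; rewrite /= (IH (ltnW vk)).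
have := @is_diff_comp _ _ _ _ (fun x => x + b) id (iterdiff g vs)
  ('d (iterdiff g vs) (x + b)) x.
move=> H; have {}H := H _ (differentiableP (dg _)).
suff /H[_ E] : is_diff x (fun x => x + b) id.
  exact: (congr1 (fun f : V -> V => f v) E).
by apply: is_diff_eq; rewrite addr0.
Qed.

Lemma iterdiffB k f g vs : class_C k setT f -> class_C k setT g ->
  (size vs <= k)%N ->
  iterdiff (f - g) vs = iterdiff f vs - iterdiff g vs.
Proof.
move=> Cf Cg; elim: vs => [|v vs IH vk]; first by move=> _; exact: erefl.
apply/funext => x; rewrite /= (IH (ltnW vk)).
have := diffB (Cf.1 vs x vk I) (Cg.1 vs x vk I).
exact: (congr1 (fun f : V -> V => f v)).
Qed.

Lemma class_C_shift k g b : class_C k setT g ->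
  class_C k setT (fun x => g (x + b)).
Proof.
move=> Cg; split=> vs x vk _.
  rewrite (iterdiff_shift b Cg (ltnW vk)).
  apply: (@differentiable_comp _ _ _ _ (fun x => x + b)).
    by apply: differentiableD; [exact: ex_diff|exact: differentiable_cst].
  exact: Cg.1.
rewrite (iterdiff_shift b Cg (eq_leq vk)).
apply: (@continuous_comp _ _ _ (fun x => x + b)); last exact: Cg.2.
apply: continuousD; [exact: cvg_id|exact: cst_continuous].
Qed.

Lemma class_CB k f g : class_C k setT f -> class_C k setT g ->
  class_C k setT (f - g).
Proof.
move=> Cf Cg; split=> vs x vk _.
  rewrite (iterdiffB Cf Cg (ltnW vk)).
  by apply: differentiableB; [exact: Cf.1|exact: Cg.1].
rewrite (iterdiffB Cf Cg (eq_leq vk)).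
by apply: continuousB; [exact: Cf.2|exact: Cg.2].
Qed.

End Calculus.

(** * Growth at the origin and vanishing differentials *)

Section VanishingDerivatives.
Context {R : realType} {n : nat}.
Local Notation V := 'rV[R]_n.
Implicit Types (F g : V -> V) (x y v : V) (vs : seq V).

Lemma continuous0P F : {for 0, continuous F} ->
  forall e : R, 0 < e -> exists2 d : R, 0 < d &
    forall x, `|x| < d -> `|F x - F 0| < e.
Proof.
move=> /cvgrPdist_lt cF e /cF/nbhs_ballP[d /= d0 H]; exists d => // x xd.
by rewrite distrC; apply: H; rewrite -ball_normE /= sub0r normrN.
Qed.

(** Induction on the number [d] of differentiations missing to reach order [j]: at order [j]
    continuity gives boundedness, and below it the mean value theorem from 0 gains one power of
    [|x|]. Directions are reduced to basis vectors, so that finitely many constants and radii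
    suffice. *)
Lemma iterdiff_bigO j g : class_C j setT g ->
  (forall vs, (size vs < j)%N -> iterdiff g vs 0 = 0) ->
  forall d vs, (size vs + d)%N = j -> exists C : R, exists2 r : R, 0 < r &
    0 <= C /\ forall x, `|x| < r -> `|iterdiff g vs x| <= C * `|x| ^+ d.
Proof.
move=> Cg g0; elim=> [|d IH] vs.
  rewrite addn0 => vj.
  have [r r0 H] := continuous0P (Cg.2 vs 0 vj I) ltr01.
  exists (`|iterdiff g vs 0| + 1), r => //; split; first exact: addr_ge0.
  move=> x /H /ltW xr; rewrite expr0 mulr1 -lerBlDl.
  by apply: le_trans xr; exact: lerB_dist.
rewrite addnS -addSn => vj.
have /choice[C] (i : 'I_n) := IH (delta_mx ord0 i :: vs) vj.
move=> /(_ _)/cid2-/all_tag[r rP].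
have vltj : (size vs < j)%N by rewrite -vj addSn ltnS leq_addr.
pose r0 := \big[Num.min/1]_i r i.
exists (\sum_i C i), r0.
  by apply/bigmin_gtP; split => // i _; case: (rP i).
have C0 i : 0 <= C i by case: (rP i) => _ [].
split=> [|x xr]; first exact: sumr_ge0.
apply: norm_le_coord => [|c].
  by apply: mulr_ge0; rewrite ?exprn_ge0 // sumr_ge0.
have dF y : differentiable (iterdiff g vs) y by apply: Cg.1.
have [t [/andP[t0 t1]]] := mvt_coord 0 x c dF.
rewrite !add0r g0 // mxE subr0 => ->.
rewrite diff_rowE summxE.
apply: le_trans (ler_norm_sum _ _ _) _.
rewrite mulr_suml; apply: ler_sum => i _.
rewrite mxE normrM exprS mulrCA; apply: ler_pM => //.
  exact: coord_le_norm.
apply: le_trans (coord_le_norm _ _) _.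
have txx : `|t *: x| <= `|x|.
  by rewrite normrZ ger0_norm // ler_piMl.
have [_ [_ /(_ (t *: x))]] := rP i.
move=> /(_ _)/le_trans; apply.
  apply: le_lt_trans txx (lt_le_trans xr _); exact: bigmin_le.
by rewrite ler_wpM2l // lerXn2r ?nnegrE.
Qed.

(** The first differentials are [O(|x|^j)] by the preceding bound, and the segment between two
    points of a ball stays in it. *)
Lemma lipschitz_near j g : class_C j.+1 setT g ->
  (forall vs, (size vs < j.+1)%N -> iterdiff g vs 0 = 0) ->
  exists C : R, exists2 r : R, 0 < r & 0 <= C /\ forall s x y, s < r ->
    `|x| <= s -> `|y| <= s -> `|g y - g x| <= C * s ^+ j * `|y - x|.
Proof.
move=> Cg g0.
have /choice[C] (i : 'I_n) :=
  iterdiff_bigO Cg g0 (vs := [:: delta_mx ord0 i]) (erefl j.+1).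
move=> /(_ _)/cid2-/all_tag[r rP].
have C0 i : 0 <= C i by case: (rP i) => _ [].
exists (\sum_i C i), (\big[Num.min/1]_i r i).
  by apply/bigmin_gtP; split => // i _; case: (rP i).
split=> [|s x y sr xs ys]; first exact: sumr_ge0.
have s0 : 0 <= s by apply: le_trans xs.
apply: norm_le_coord => [|c].
  by rewrite !mulr_ge0 ?exprn_ge0 // sumr_ge0.
have dg z : differentiable g z by apply: (Cg.1 [::]).
have [t [/andP[t0 t1]]] := mvt_coord x (y - x) c dg.
rewrite (addrC x (y - x)) subrK => E; rewrite !mxE E {E}.
rewrite diff_rowE summxE.
apply: le_trans (ler_norm_sum _ _ _) _.
rewrite !mulr_suml; apply: ler_sum => i _.
rewrite mxE normrM mulrC; apply: ler_pM => //; last first.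
  exact: coord_le_norm.
apply: le_trans (coord_le_norm _ _) _.
set z := x + _.
have zs : `|z| <= s.
  have -> : z = (1 - t) *: x + t *: y.
    by apply/rowP => k; rewrite !mxE; ring.
  apply: le_trans (ler_normD _ _) _; rewrite !normrZ !ger0_norm ?subr_ge0 //.
  have -> : s = (1 - t) * s + t * s by ring.
  by apply: lerD; apply: ler_wpM2l; rewrite ?subr_ge0.
have [_ [_ /(_ z)]] := rP i.
move=> /(_ _)/le_trans; apply.
  apply: le_lt_trans zs (lt_le_trans sr _); exact: bigmin_le.
by rewrite ler_wpM2l // lerXn2r ?nnegrE.
Qed.

(** Iterated forward difference with steps [t v]. The head of the list acts first here but last in
    [iterdiff]; an induction on the list can then be applied to the first difference of [g]. *)
Fixpoint iterdelta (t : R) vs g : V -> V :=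
  match vs with
  | [::] => g
  | v :: vs' => iterdelta t vs' ((fun x => g (x + t *: v)) - g)
  end.

Definition normsum vs : R := \sum_(v <- vs) `|v|.

Lemma normsum_ge0 vs : 0 <= normsum vs.
Proof. exact: sumr_ge0. Qed.

(** Apply the induction to the first difference of [g], whose differential along [vs] is the
    difference of that of [g] at two points [t v] apart; the mean value theorem supplies the last
    direction and moves the point by at most [t |v|]. *)
Lemma iterdelta_mvt (t : R) vs g x (c : 'I_n) : 0 <= t ->
  class_C (size vs) setT g ->
  exists2 xi, `|xi - x| <= t * normsum vs &
    iterdelta t vs g x ord0 c = t ^+ size vs * iterdiff g vs xi ord0 c.
Proof.
move=> t0; elim: vs g => [|v vs IH] g Cg.
  by exists x; rewrite ?subrr ?normr0 ?mulr_ge0 ?normsum_ge0 // expr0 mul1r.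
have Cs := class_C_shift (t *: v) Cg.
have [|xi xix E] := IH ((fun x => g (x + t *: v)) - g).
  exact: class_C_le (leqnSn _) (class_CB Cs Cg).
have dF y : differentiable (iterdiff g vs) y by apply: Cg.1.
have [s [/andP[s0 s1]]] := mvt_coord xi (t *: v) c dF.
move=> D; exists (xi + s *: (t *: v)).
  rewrite /normsum big_cons mulrDr.
  have -> : xi + s *: (t *: v) - x = s *: (t *: v) + (xi - x).
    by rewrite [RHS]addrC addrAC.
  apply: le_trans (ler_normD _ _) _; apply: lerD => //.
  rewrite !normrZ (ger0_norm s0) (ger0_norm t0) ler_piMl //.
  exact: mulr_ge0.
have ltvs : (size vs <= size (v :: vs))%N by [].
rewrite /= E (iterdiffB Cs Cg ltvs) (iterdiff_shift (t *: v) Cg ltvs).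
rewrite [X in _ * X](_ : _ =
    iterdiff g vs (xi + t *: v) ord0 c - iterdiff g vs xi ord0 c); last first.
  by rewrite !mxE.
rewrite D linearZ mxE exprS mulrCA mulrA; exact: erefl.
Qed.

(** The iterated difference is a signed sum of [2 ^ size vs] values of [g] at points within
    [t * normsum vs] of [x]; in the induction each direction doubles the bound and costs [t |v|] of
    the radius. *)
Lemma norm_iterdelta (t r e : R) vs g x : 0 <= t ->
  (forall y, `|y| <= r -> `|g y| <= e) -> `|x| + t * normsum vs <= r ->
  `|iterdelta t vs g x| <= 2 ^+ size vs * e.
Proof.
move=> t0; elim: vs g r e => [|v vs IH] g r e ge xr /=.
  rewrite mul1r; apply: ge; apply: le_trans xr.
  by rewrite lerDl mulr_ge0 // normsum_ge0.
move: xr; rewrite /normsum big_cons mulrDr -/(normsum vs) => xr.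
have -> : 2 ^+ (size vs).+1 * e = 2 ^+ size vs * (2 * e).
  by rewrite exprS; ring.
apply: (IH _ (r - t * `|v|)) => [y yr|]; last first.
  by rewrite lerBrDr -addrA (addrC _ (t * _)).
rewrite mulrDl mul1r; apply: le_trans (ler_normB _ _) _.
have tv : 0 <= t * `|v| by rewrite mulr_ge0.
apply: lerD; apply: ge.
  apply: le_trans (ler_normD _ _) _.
  by rewrite normrZ (ger0_norm t0) -lerBrDr.
by apply: le_trans yr _; rewrite gerBl.
Qed.

(* The iterated difference of [g] at scale [t] is [t ^ i] times an [i]-th
   derivative at a nearby point, which avoids the symmetry of [D^i g]. *)
Lemma littleo_iterdiff0 g vs : class_C (size vs) setT g ->
  (forall e : R, 0 < e -> exists2 d : R, 0 < d &
     forall x, `|x| < d -> `|g x| <= e * `|x| ^+ size vs) ->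
  iterdiff g vs 0 = 0.
Proof.
move=> Cg go; apply/rowP => c; rewrite mxE; apply/eqP; rewrite -normr_le0.
apply/ler_addgt0Pr => e e0; rewrite add0r.
set i := size vs in go *.
pose M := normsum vs + 1.
have M0 : 0 < M by rewrite ltr_wpDl ?normsum_ge0.
have [d1 d10 H1] := continuous0P (Cg.2 vs 0 erefl I) (divr_gt0 e0 (ltr0Sn R 1)).
(* [2 ^ i] counts the terms of the difference and [M ^ i] comes from evaluating [g] up to radius
   [t M]; after division by [t ^ i] there remains [e / 2], the other half being spent on continuity
   of the differential at 0. *)
pose e' := e / 2 / (2 ^+ i * M ^+ i).
have e'0 : 0 < e' by rewrite divr_gt0 ?mulr_gt0 ?exprn_gt0 // divr_gt0.
have [d2 d20 H2] := go _ e'0.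
pose t := Num.min d1 d2 / (2 * M).
have t0 : 0 < t by rewrite divr_gt0 ?mulr_gt0 // lt_min d10.
have tM : t * M < Num.min d1 d2.
  rewrite /t invfM mulrA -mulrA mulVf ?gt_eqF // mulr1.
  by rewrite gtr_pMr ?invf_lt1 ?lt_min ?d10 // ltr1n.
have tM' : t * normsum vs <= t * M by rewrite ler_pM2l // lerDl.
have [xi xix E] := iterdelta_mvt 0 c (ltW t0) Cg.
have B : `|iterdelta t vs g 0| <= 2 ^+ i * (e' * (t * M) ^+ i).
  apply: (norm_iterdelta (r := t * M)) => [||].
  - exact: ltW.
  - move=> y yM; apply: le_trans (H2 _ _) _.
      by apply: le_lt_trans yM (lt_le_trans tM _); rewrite ge_min lexx orbT.
    rewrite ler_pM2l // lerXn2r ?nnegrE //.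
    by rewrite mulr_ge0 // ltW.
  - by rewrite normr0 add0r.
have X : `|iterdiff g vs xi ord0 c| <= e / 2.
  have := le_trans (coord_le_norm _ c) B; rewrite E normrM.
  rewrite ger0_norm ?exprn_ge0 ?(ltW t0) // [(t * M) ^+ i]exprMn.
  rewrite -/i /e' => H.
  have ti : 0 < t ^+ i by rewrite exprn_gt0.
  rewrite -(ler_pM2l ti); apply: le_trans H _.
  rewrite le_eqVlt; apply/orP; left; apply/eqP.
  field; apply/andP; split; rewrite expf_neq0 ?gt_eqF //.
have Y : `|(iterdiff g vs xi - iterdiff g vs 0) ord0 c| <= e / 2.
  apply: le_trans (coord_le_norm _ _) (ltW (H1 _ _)).
  rewrite -[xi]subr0; apply: le_lt_trans xix (le_lt_trans tM' (lt_le_trans tM _)).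
  by rewrite ge_min lexx.
rewrite !mxE in Y.
rewrite -(subKr (iterdiff g vs xi ord0 c) (iterdiff g vs 0 ord0 c)).
apply: le_trans (ler_normB _ _) _.
by rewrite [e]splitr; apply: lerD.
Qed.

Lemma dense_iterdiff0 i g : class_C i setT g -> g 0 = 0 ->
  (forall e : R, 0 < e -> exists2 d : R, 0 < d & forall z, `|z| < d ->
     exists2 y, `|y - z| <= e * `|z| & `|g y| <= e * `|z| ^+ i) ->
  forall vs, (size vs <= i)%N -> iterdiff g vs 0 = 0.
Proof.
move=> Cg g0 gd.
suff H j : (j <= i)%N -> forall vs, (size vs <= j)%N -> iterdiff g vs 0 = 0.
  by move=> vs vi; exact: (H (size vs)).
elim: j => [_ [|//]|j IH ji vs]; first by [].
rewrite leq_eqVlt => /predU1P[vj|]; last by rewrite ltnS; apply: IH; exact: ltnW.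
apply: littleo_iterdiff0; rewrite vj; first exact: class_C_le Cg.
have [//|C [r r0 [C0 L]]] := lipschitz_near (class_C_le ji Cg).
  by move=> ws; rewrite ltnS; apply: IH; exact: ltnW.
move=> e e0.
(* The bound by 1 keeps [y] in the ball of radius [2 |z|], where the Lipschitz constant is
   [C (2 |z|)^j]; the other bound absorbs the sum of the two errors. *)
pose e' := Num.min 1 (e / (1 + C * 2 ^+ j)).
have D0 : 0 < 1 + C * 2 ^+ j by rewrite ltr_pwDl // mulr_ge0 // exprn_ge0.
have e'0 : 0 < e' by rewrite lt_min ltr01 divr_gt0.
have e'1 : e' <= 1 by rewrite ge_min lexx.
have [d d0 H] := gd _ e'0.
exists (Num.min (Num.min d 1) (r / 2)).
  by rewrite !lt_min d0 ltr01 divr_gt0.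
move=> z; rewrite !lt_min => /andP[/andP[zd z1] zr].
have [y yz gy] := H _ zd.
have y2z : `|y| <= 2 * `|z|.
  rewrite -(subrK z y); apply: le_trans (ler_normD _ _) _.
  rewrite mulrDl mul1r lerD2r; apply: le_trans yz _.
  by rewrite ler_piMl.
have := L (2 * `|z|) y z _ y2z _.
have z2 : `|z| <= 2 * `|z| by rewrite ler_peMl // ler1n.
have zr2 : 2 * `|z| < r by rewrite mulrC -ltr_pdivlMr.
move=> /(_ zr2 z2) {}L.
rewrite -(subrK (g y) (g z)); apply: le_trans (ler_normD _ _) _.
apply: (@le_trans _ _ ((C * 2 ^+ j * e') * `|z| ^+ j.+1 + e' * `|z| ^+ j.+1)).
  apply: lerD.
    apply: le_trans L _; rewrite distrC.
    apply: (@le_trans _ _ (C * (2 * `|z|) ^+ j * (e' * `|z|))).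
      by rewrite ler_wpM2l // mulr_ge0 // exprn_ge0 // mulr_ge0.
    by rewrite le_eqVlt exprMn exprS; apply/orP; left; apply/eqP; ring.
  apply: le_trans gy _; rewrite ler_wpM2l ?(ltW e'0) //.
  by apply: ler_wiXn2l => //; exact: ltW.
rewrite -mulrDl ler_wpM2r ?exprn_ge0 //.
rewrite -[X in _ + X]mul1r -mulrDl addrC mulrC -ler_pdivlMr //.
by rewrite ge_min lexx orbT.
Qed.

End VanishingDerivatives.

(** * Polynomial maps *)

Section PolynomialMaps.
Context {R : realType} {n : nat}.
Local Notation V := 'rV[R]_n.

(** Polynomial maps of degree at most [d], characterised by their differentials: in every direction
    the degree drops by one. Smoothness of every order and constancy of the [d]-th differential
    follow without coordinates. *)
Fixpoint polymap {W : normedModType R} (d : nat) (f : V -> W) : Prop :=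
  if d is d'.+1 then
    (forall x, differentiable f x) /\ forall v, polymap d' (fun x => 'd f x v)
  else exists c, f = cst c.

Section NormedTarget.
Context {W : normedModType R}.
Implicit Types (f g : V -> W) (x v b : V).

Lemma polymap_cst d (c : W) : polymap d (cst c : V -> W).
Proof.
elim: d c => [|d IH] c; first by exists c.
split=> [x|v]; first exact: differentiable_cst.
have -> : (fun x => 'd (cst c : V -> W) x v) = cst 0.
  by apply/funext => x; rewrite diff_cst.
exact: IH.
Qed.

Lemma polymap_diff d f x : polymap d f -> differentiable f x.
Proof. by case: d => [[c ->]|d [df _]]; [exact: differentiable_cst|exact: df]. Qed.

Lemma polymapS d f : polymap d f -> polymap d.+1 f.
Proof.
elim: d f => [f [c ->]|d IH f [df pf]]; first exact: polymap_cst.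
split=> [|v]; first exact: df.
by apply: IH; exact: pf.
Qed.

Lemma polymap_le d e f : (d <= e)%N -> polymap d f -> polymap e f.
Proof.
by move=> /subnK <-; elim: (e - d)%N => // k IH /IH; exact: polymapS.
Qed.

Lemma polymap_D d f v : polymap d f -> polymap d.-1 (fun x => 'd f x v).
Proof.
case: d => [[c ->]|d [_ pf]]; last exact: pf.
exists 0; apply/funext => x; by rewrite diff_cst.
Qed.

Lemma polymapD d f g : polymap d f -> polymap d g -> polymap d (f + g).
Proof.
elim: d f g => [|d IH] f g; first by move=> [c ->] [c' ->]; exists (c + c').
move=> [df pf] [dg pg]; split=> [x|v]; first exact: differentiableD.
have -> : (fun x => 'd (f + g) x v) =
    (fun x => 'd f x v) + (fun x => 'd g x v).
  apply/funext => x; exact: (congr1 (fun h : V -> W => h v) (diffD (df x) (dg x))).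
by apply: IH; [exact: pf|exact: pg].
Qed.

Lemma polymapZ d (k : R) f : polymap d f -> polymap d (k *: f).
Proof.
elim: d f => [|d IH] f; first by move=> [c ->]; exists (k *: c).
move=> [df pf]; split=> [x|v]; first exact: differentiableZ.
have -> : (fun x => 'd (k *: f) x v) = k *: (fun x => 'd f x v).
  by apply/funext => x; exact: (congr1 (fun h : V -> W => h v) (diffZ k (df x))).
by apply: IH; exact: pf.
Qed.

Lemma polymap_sum d I (s : seq I) (P : pred I) (F : I -> V -> W) :
  (forall i, P i -> polymap d (F i)) ->
  polymap d (fun x => \sum_(i <- s | P i) F i x).
Proof.
move=> pF; have -> : (fun x => \sum_(i <- s | P i) F i x) = \sum_(i <- s | P i) F i.
  by apply/funext => x; rewrite fct_sumE.
elim/big_ind: _ => //; first exact: polymap_cst.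
by move=> f g; exact: polymapD.
Qed.

Lemma polymap_linear (f : {linear V -> W}) : polymap 1 f.
Proof.
split=> [x|v]; first exact: linear_differentiable_rV.
by exists (f v); apply/funext => x; rewrite diff_linear_rV.
Qed.

Lemma polymap_shift d f b : polymap d f -> polymap d (fun x => f (x + b)).
Proof.
elim: d f => [|d IH] f; first by move=> [c ->]; exists c.
move=> [df pf].
have E x : is_diff x (fun x => f (x + b)) ('d f (x + b)).
  have H := @is_diff_comp _ _ _ _ (fun x => x + b) id f ('d f (x + b)) x.
  apply: H; last exact: differentiableP (df _).
  by apply: is_diff_eq; rewrite addr0.
split=> [x|v]; first by case: (E x).
have -> : (fun x => 'd (fun x0 => f (x0 + b)) x v) = (fun x => 'd f (x + b) v).
  apply/funext => x; case: (E x) => _.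
  exact: (congr1 (fun h : V -> W => h v)).
exact: IH (pf v).
Qed.

End NormedTarget.

Lemma polymap_scale (W : normedModType R) d (p : V -> R) (c : W) :
  polymap d p -> polymap d (fun x => p x *: c).
Proof.
elim: d p => [|d IH] p.
  by move=> [k ->]; exists (k *: c).
move=> [dp pp]; split=> [x|v]; first exact: differentiableZl.
have -> : (fun x => 'd (fun x0 => p x0 *: c) x v) = (fun x => 'd p x v *: c).
  by apply/funext => x; exact: (congr1 (fun h : V -> W => h v) (diffZl c (dp x))).
exact: IH (pp v).
Qed.

(** By the product rule the differential of [l p] in direction [v] is [l Dp(v) + l(v) p], and both
    terms have degree at most [d]. Linear factors suffice to build monomials. *)
Lemma polymap_mul_linear d (p : V -> R) (l : {linear V -> R}) :
  polymap d p -> polymap d.+1 (fun x => l x * p x).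
Proof.
elim: d p => [|d IH] p pp.
  have [k ->] := pp; have -> : (fun x => l x * cst k x) = k *: (l : V -> R).
    by apply/funext => x; rewrite mulrC.
  by apply: polymapZ; exact: polymap_linear.
have dp x := polymap_diff x pp.
have E x : is_diff x (fun x => l x * p x) 
    (fun v => l x * 'd p x v + p x * l v).
  have := @is_diffM _ _ _ _ _ _ x (is_diff_linear_rV l x) (differentiableP (dp x)).
  exact: id.
split=> [x|v]; first by case: (E x).
have -> : (fun x => 'd (fun x => l x * p x) x v) =
   (fun x => l x * 'd p x v) + l v *: p.
  apply/funext => x; case: (E x) => _ Ex.
  apply: etrans (congr1 (fun h : V -> R => h v) Ex) _.
  by congr (_ + _); exact: mulrC.
apply: polymapD; last exact: polymapZ pp.
by apply: IH; exact: (pp.2 v).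
Qed.

Lemma polymap_monomial I (s : seq I) (b : I -> nat) (l : I -> {linear V -> R}) :
  polymap (\sum_(i <- s) b i)%N (fun x => \prod_(i <- s) l i x ^+ b i).
Proof.
elim: s => [|i s IH].
  rewrite big_nil; exists 1; by apply/funext => x; rewrite big_nil.
rewrite big_cons.
have -> : (fun x => \prod_(j <- i :: s) l j x ^+ b j) =
  (fun x => l i x ^+ b i * \prod_(j <- s) l j x ^+ b j).
  by apply/funext => x; rewrite big_cons.
elim: (b i) => [|e IHe].
  have -> : (fun x => l i x ^+ 0 * \prod_(j <- s) l j x ^+ b j) =
    (fun x => \prod_(j <- s) l j x ^+ b j).
    by apply/funext => x; rewrite mul1r.
  exact: IH.
have -> : (fun x => l i x ^+ e.+1 * \prod_(j <- s) l j x ^+ b j) =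
    (fun x => l i x * (l i x ^+ e * \prod_(j <- s) l j x ^+ b j)).
  by apply/funext => x; rewrite exprS mulrA.
exact: polymap_mul_linear.
Qed.

Lemma polymap_iterdiff d (f : V -> V) vs :
  polymap d f -> polymap (d - size vs) (iterdiff f vs).
Proof.
move=> pf; elim: vs => [|v vs IH]; first by rewrite subn0.
by rewrite /= subnS; exact: polymap_D.
Qed.

Lemma polymap_class_C d k U (f : V -> V) : polymap d f -> class_C k U f.
Proof.
move=> pf; split=> vs x _ _.
  exact: polymap_diff (polymap_iterdiff vs pf).
by apply: differentiable_continuous; exact: polymap_diff (polymap_iterdiff vs pf).
Qed.

(** The [k]-th differential of a polynomial map of degree at most [k] is constant, hence Hoelder
    with constant 0 for every exponent. *)
Lemma polymap_class_Calpha k (alpha : R) U (f : V -> V) : polymap k f ->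
  class_Calpha k alpha U f.
Proof.
move=> pf; split=> [|a0 x0 _]; first exact: polymap_class_C pf.
exists 1, 0; split=> // x y _ _ _ _ vs.
have := polymap_iterdiff vs pf; rewrite size_tuple subnn => -[c E].
rewrite /Diter E /cst subrr enorm0 !mul0r; exact: lexx.
Qed.

End PolynomialMaps.

(** * Polynomial functions on a plane: growth at the origin and truncation *)

Section PolynomialGraphs.
Context {R : realType} {n : nat}.
Local Notation V := 'rV[R]_n.
Implicit Types (T : {vspace V}) (P : V -> V).

Section Coordinates.
Variables (T : {vspace V}) (j : 'I_(\dim T)).

Definition coordT (x : V) : R := coord (vbasis T) j (orthproj T x).

Lemma coordT_linear : linear coordT.
Proof. by move=> k x y; rewrite /coordT orthprojD orthprojZ linearD linearZ. Qed.

HB.instance Definition _ := GRing.isLinear.Build _ _ _ _ coordT coordT_linear.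

End Coordinates.

Definition monoT T k (b : {ffun 'I_(\dim T) -> 'I_k.+1}) (x : V) : R :=
  \prod_j coordT j x ^+ b j.

Lemma polymap_monoT T k (b : {ffun 'I_(\dim T) -> 'I_k.+1}) :
  polymap (\sum_j b j) (monoT b).
Proof. exact: (polymap_monomial _ (fun j => b j : nat) (fun j => coordT j : {linear V -> R})). Qed.

(** Each coordinate is bounded by [K |x|], and where [K |x| <= 1] the exponent may be lowered from
    the degree to [i]. *)
Lemma monoT_le T : exists2 K : R, 0 < K &
  forall k (b : {ffun 'I_(\dim T) -> 'I_k.+1}) i (x : V),
    K * `|x| <= 1 -> (i <= \sum_j b j)%N -> `|monoT b x| <= (K * `|x|) ^+ i.
Proof.
have /choice[K KP] (j : 'I_(\dim T)) : exists K : R, 0 < K /\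
    forall x, `|coordT j x| <= K * `|x|.
  have [|K K0 H] := @linear_lipschitz R V R (coordT j : {linear V -> R}).
    by move=> x; apply: differentiable_continuous; exact: linear_differentiable_rV.
  by exists K.
exists (1 + \sum_j K j).
  by rewrite ltr_pwDl // sumr_ge0 // => j _; apply: ltW; case: (KP j).
set C := 1 + _ => k b i x x1 ib.
have C0 : 0 <= C * `|x|.
  rewrite mulr_ge0 // addr_ge0 // sumr_ge0 // => j _; apply: ltW; by case: (KP j).
rewrite /monoT normr_prod.
apply: (@le_trans _ _ (\prod_j (C * `|x|) ^+ b j)).
  apply: ler_prod => j _; rewrite normr_ge0 /= normrX.
  rewrite lerXn2r ?nnegrE //.
  apply: le_trans ((KP j).2 x) _; rewrite ler_wpM2r //.
  rewrite /C (bigD1 j) //= addrCA lerDl addr_ge0 // sumr_ge0 // => l _.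
  by apply: ltW; case: (KP l).
by rewrite prodrXr; apply: ler_wiXn2l.
Qed.

Lemma polyfun_onP T k P : polyfun_on T k P ->
  exists c : {ffun 'I_(\dim T) -> 'I_k.+1} -> V, P \o orthproj T =
    fun x => \sum_(b : {ffun 'I_(\dim T) -> 'I_k.+1} | (\sum_j b j <= k)%N)
      monoT b x *: c b.
Proof.
move=> [c H]; exists c; apply/funext => x /=.
by rewrite H ?orthproj_mem.
Qed.

Lemma polyfun_polymap T k P : polyfun_on T k P -> polymap k (P \o orthproj T).
Proof.
move=> /polyfun_onP[c ->]; apply: polymap_sum => b bk; apply: polymap_scale.
by apply: polymap_le bk _; exact: polymap_monoT.
Qed.

(** The value and the differential vanish at 0, so [lipschitz_near] applies with [j = 1]. The
    Lipschitz form serves twice: from the origin it gives [|P y| <= C |y|^2], and it compares values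
    at nearby base points. *)
Lemma polyfun_quadratic T k P : polyfun_on T k P -> P 0 = 0 ->
  is_diff (0 : V) (P \o orthproj T) (fun=> 0) ->
  exists C r : R, [/\ 0 <= C, 0 < r & forall s x y, s < r -> x \in T -> y \in T ->
    enorm x <= s -> enorm y <= s -> enorm (P y - P x) <= C * s * enorm (y - x)].
Proof.
move=> pP P0 [_ dP].
have CP := polymap_class_C 2 setT (polyfun_polymap pP).
have [|C [r r0 [C0 H]]] := @lipschitz_near _ _ 1 _ CP.
  move=> [_|v [|//] _]; first by rewrite /= orthproj0.
  exact: (congr1 (fun h : V -> V => h v) dP).
exists (n.+1%:R * C), r; split=> [||s x y sr xT yT xs ys] //.
  by rewrite mulr_ge0.
have := H s x y sr (le_trans (norm_le_enorm _) xs) (le_trans (norm_le_enorm _) ys).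
rewrite /= !orthproj_id // expr1 => {}H.
apply: le_trans (enorm_le_norm _) _.
rewrite -!mulrA ler_wpM2l //; apply: le_trans H _.
rewrite -mulrA ler_wpM2l // ler_wpM2l //; last exact: norm_le_enorm.
by apply: le_trans xs; exact: enorm_ge0.
Qed.

(** Discarding the monomials of degree above [i] changes the value by [O(|x|^(i+1))]. This provides
    the polynomial of each lower order from the one of order [k]. *)
Lemma polyfun_trunc T k i P : (1 <= i <= k)%N -> polyfun_on T k P ->
  maps_to_orth T P -> P 0 = 0 ->
  is_diff (0 : V) (P \o orthproj T) (fun=> 0) ->
  exists P', [/\ maps_to_orth T P', polyfun_on T i P', P' 0 = 0,
    is_diff (0 : V) (P' \o orthproj T) (fun=> 0) &
    exists C r : R, [/\ 0 <= C, 0 < r & forall x, x \in T -> enorm x < r ->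
      enorm (P x - P' x) <= C * enorm x ^+ i.+1]].
Proof.
move=> /andP[i0 ik] [c Pc] Pto P0 [_ dP].
(* The range of a multi-index depends on the degree bound; [h] and [h'] identify the multi-indices
   of total degree at most [i] in the two ranges. *)
pose h (b : {ffun 'I_(\dim T) -> 'I_i.+1}) : {ffun 'I_(\dim T) -> 'I_k.+1} :=
  [ffun j => widen_ord (ik : (i.+1 <= k.+1)%N) (b j)].
pose h' (b : {ffun 'I_(\dim T) -> 'I_k.+1}) : {ffun 'I_(\dim T) -> 'I_i.+1} :=
  [ffun j => inord (b j)].
(* Only the values of [P] are given to lie in the complement; projecting the coefficients leaves [P]
   unchanged on [T] and avoids the linear independence of monomials. *)
pose c' b := orthproj (orthv T) (c b).
pose P' (x : V) : V :=
  \sum_(b : {ffun 'I_(\dim T) -> 'I_i.+1} | (\sum_j b j <= i)%N)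
     (\prod_j coord (vbasis T) j x ^+ b j) *: c' (h b).
pose Q (x : V) : V :=
  \sum_(b : {ffun 'I_(\dim T) -> 'I_k.+1} |
      (\sum_j b j <= k)%N && ~~ (\sum_j b j <= i)%N) monoT b x *: c' b.
have PE x : x \in T -> P x = P' x + Q x.
  move=> xT; rewrite -[LHS](orthproj_id (Pto x xT)) (Pc x xT) orthproj_sum.
  rewrite (bigID (fun b : {ffun 'I_(\dim T) -> 'I_k.+1} => (\sum_j b j <= i)%N)) /=; congr (_ + _).
    rewrite (reindex_onto h h') /=; last first.
      move=> b /andP[_ bi]; apply/ffunP => j; rewrite !ffunE; apply: val_inj => /=.
      by rewrite inordK // ltnS; apply: leq_trans bi; rewrite (bigD1 j) //= leq_addr.
    apply: eq_big => [b|b _].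
      have -> : (\sum_j h b j = \sum_j b j)%N by apply: eq_bigr => j _; rewrite ffunE.
      have -> : h' (h b) == b.
        by apply/eqP/ffunP => j; rewrite !ffunE; apply: val_inj; rewrite /= inordK.
      rewrite andbT; apply/andP/idP => [[]//|bi]; split=> //; exact: (leq_trans bi ik).
    rewrite orthprojZ; congr (_ *: _); apply: eq_bigr => j _; by rewrite ffunE.
  apply: eq_bigr => b _; rewrite orthprojZ; congr (_ *: _).
  by apply: eq_bigr => j _; rewrite /coordT orthproj_id.
have P'to : maps_to_orth T P'.
  move=> x xT; apply: memv_suml => b _; apply: memvZ; exact: orthproj_mem.
have pP' : polyfun_on T i P' by exists (fun b => c' (h b)).
have [K K0 KH] := monoT_le T.
pose M := \sum_(b : {ffun 'I_(\dim T) -> 'I_k.+1}) `|c' b|.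
have M0 : 0 <= M by exact: sumr_ge0.
have Qle (x : V) : K * `|x| <= 1 -> `|Q x| <= M * K ^+ i.+1 * `|x| ^+ i.+1.
  move=> x1; rewrite /Q; apply: le_trans (ler_norm_sum _ _ _) _.
  rewrite -mulrA -exprMn mulr_suml big_mkcond /=; apply: ler_sum => b _.
  case: ifP => [/andP[_ bi]|_]; last by rewrite mulr_ge0 // exprn_ge0 // mulr_ge0 // ltW.
  rewrite normrZ mulrC ler_wpM2l //; apply: KH => //.
  by rewrite ltnNge.
have Q0 : Q 0 = 0.
  apply/eqP; rewrite -normr_le0; apply: le_trans (Qle _ _) _; rewrite normr0.
    by rewrite mulr0.
  by rewrite expr0n mulr0.
have pQ : polymap k ((P \o orthproj T) - (P' \o orthproj T)).
  apply: polymapD; first by apply: polyfun_polymap; exists c.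
  rewrite -scaleN1r; apply: polymapZ; apply: (polymap_le ik); exact: polyfun_polymap.
have QE x : ((P \o orthproj T) - (P' \o orthproj T)) x = Q (orthproj T x).
  rewrite -[LHS]/(P (orthproj T x) - P' (orthproj T x)).
  by rewrite PE ?orthproj_mem // addrC addKr.
have MK0 : 0 <= M * K ^+ i.+1 by rewrite mulr_ge0 // exprn_ge0 // ltW.
(* As [i >= 1], the discarded part is [O(|x|^2)], so the truncation keeps a zero differential at the
   origin. *)
have dQ v : 'd ((P \o orthproj T) - (P' \o orthproj T)) (0 : V) v = 0.
  apply: (littleo_iterdiff0 (vs := [:: v])); first exact: polymap_class_C pQ.
  move=> e e0; pose D := M * K ^+ i.+1 * n.+1%:R ^+ i.+1 + 1.
  have D0 : 0 < D by rewrite ltr_wpDl // mulr_ge0 // exprn_ge0.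
  exists (Num.min (Num.min 1 (K^-1 / n.+1%:R)) (e / D)).
    by rewrite !lt_min ltr01 !divr_gt0 // invr_gt0.
  move=> x; rewrite !lt_min => /andP[/andP[x1 xK] xe]; rewrite expr1 QE.
  have px : `|orthproj T x| <= n.+1%:R * `|x|.
    apply: le_trans (norm_le_enorm _) _; apply: le_trans (enorm_orthproj _ _) _.
    exact: enorm_le_norm.
  apply: le_trans (Qle _ _) _.
    rewrite mulrC -ler_pdivlMr // mul1r; apply: le_trans px _.
    by rewrite mulrC -ler_pdivlMr // ltW.
  apply: (@le_trans _ _ (M * K ^+ i.+1 * (n.+1%:R * `|x|) ^+ i.+1)).
    by rewrite ler_wpM2l // lerXn2r ?nnegrE // mulr_ge0.
  rewrite exprMn mulrA.
  apply: (@le_trans _ _ (D * `|x| ^+ i.+1)).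
    by rewrite ler_wpM2r ?exprn_ge0 // lerDl.
  apply: (@le_trans _ _ (D * `|x| ^+ 2)).
    rewrite ler_wpM2l ?(ltW D0) //; apply: ler_wiXn2l => //; exact: ltW.
  rewrite expr2 mulrA ler_wpM2r // mulrC -ler_pdivlMr //; exact: ltW.
have dP' := polymap_diff (0 : V) (polyfun_polymap pP').
have dPd : differentiable (P \o orthproj T) (0 : V).
  by apply: (@polymap_diff _ _ _ k); apply: polyfun_polymap; exists c.
exists P'; split; [exact: P'to|exact: pP'| | |].
- by have := PE 0 (mem0v _); rewrite P0 Q0 addr0.
- apply: DiffDef; first exact: dP'.
  apply/funext => v.
  have E := congr1 (fun h : V -> V => h v) (diffB dPd dP').
  have /eqP := etrans (esym E) (dQ v); rewrite subr_eq0 => /eqP <-.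
  exact: (congr1 (fun h : V -> V => h v) dP).
exists (n.+1%:R * (M * K ^+ i.+1)), K^-1; split=> [||x xT xK].
- by rewrite mulr_ge0.
- by rewrite invr_gt0.
rewrite PE // addrC addKr; apply: le_trans (enorm_le_norm _) _.
rewrite -mulrA ler_wpM2l //; apply: le_trans (Qle _ _) _.
  rewrite mulrC -ler_pdivlMr // mul1r; apply: le_trans (norm_le_enorm _) _.
  exact: ltW.
by rewrite ler_wpM2l // lerXn2r ?nnegrE ?enorm_ge0 // norm_le_enorm.
Qed.

End PolynomialGraphs.

(** * Uniqueness of the approximate tangent plane *)

Section ApproximateTangent.
Context {R : realType} {n : nat}.
Local Notation V := 'rV[R]_n.
Implicit Types (A : set V) (a x y z : V) (T : {vspace V}) (P : V -> V).

Lemma enorm_cyl T z (s t : R) x : cyl T z s t x -> enorm (x - z) <= s + t.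
Proof.
move=> [h1 h2]; apply: le_trans (enorm_split T _) _.
by apply: lerD; exact: ltW.
Qed.

Lemma edistE_le_lt B x (t t' : R) : (edistE B x <= t%:E)%E -> t < t' ->
  exists2 b : V, B b & enorm (x - b) < t'.
Proof. by move=> h tt'; apply: edistE_lt; apply: le_lt_trans h _; rewrite lte_fin. Qed.

Lemma near_graph T P x (t t' : R) : (edistE (gr T P) x <= t%:E)%E -> t < t' ->
  exists2 y, y \in T & enorm (x - (y + P y)) < t'.
Proof. by move=> /edistE_le_lt h /h [_ [y yT <-]]; exists y. Qed.

Lemma enorm_graph_base T P x y : maps_to_orth T P -> y \in T ->
  enorm y <= enorm x + enorm (x - (y + P y)).
Proof.
move=> Po yT; have h := le_enorm_add (y + P y) x.
rewrite enormBC in h; apply: le_trans h.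
by rewrite -{1}(orthproj_graph yT (Po _ yT)); exact: enorm_orthproj.
Qed.

Lemma enorm_orthv_graph T P x y : maps_to_orth T P -> y \in T ->
  enorm (orthproj (orthv T) x) <= enorm (x - (y + P y)) + enorm (P y).
Proof.
move=> Po yT; rewrite -[x in leLHS](subrK (y + P y)) orthprojD.
rewrite orthprojv_graph ?Po //; apply: le_trans (enormD _ _) _.
by rewrite lerD2r; exact: enorm_orthproj.
Qed.

Lemma edistE_graph_le T P x y : y \in T ->
  (edistE (gr T P) x <= (enorm (x - (y + P y)))%:E)%E.
Proof. by move=> yT; apply: edistE_le; exists y. Qed.

Lemma ap_cond1_ball_vol m T A : ap_cond1 m T A -> 0 < ball_vol m :> R.
Proof.
move=> /(_ 1 ltr01)[rho [eta [rho0 eta0 /(_ rho)]]].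
rewrite lexx (ltW rho0) => /(_ isT 0 (mem0v _)).
rewrite /cballE/= subrr enorm0 => /(_ (ltW rho0)) H.
apply: ball_vol_gt0 (lt_le_trans _ H).
by rewrite lte_fin mulr_gt0 // exprn_gt0.
Qed.

Lemma ap_cond1_near m T A (eps : R) : ap_cond1 m T A -> 0 < eps ->
  exists2 eta : R, 0 < eta & \forall r \near (0 : R)^'+,
    forall z, z \in T -> enorm z <= r ->
      ((eta * r ^+ m)%:E <=
         hausdorff m (cyl T z (eps * r) (eps * r) `&` A))%E.
Proof.
move=> c1 /c1[rho [eta [rho0 eta0 H]]]; exists eta => //.
apply/at_rightP; exists rho => // r r0 rr z zT zr.
by apply: H; rewrite ?(ltW r0) ?(ltW rr) // /cballE/= subr0.
Qed.

Lemma ap_cond2_littleo m k (alpha : R) T P A (eps : R) : 0 < ball_vol m :> R ->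
  ap_cond2 m k alpha T P A -> 0 < eps ->
  right_littleo m (fun r => hausdorff m (off_graph T P (eps * r ^+ k) r A)).
Proof.
move=> bv [c2 _] /c2; move/density_cvg0P; apply => //.
by move=> r; exact: hausdorff_ge0.
Qed.

Definition quadratic_on T P (C r0 : R) : Prop :=
  [/\ 0 <= C, 0 < r0 &
      forall y, y \in T -> enorm y < r0 -> enorm (P y) <= C * enorm y ^+ 2].

Lemma ap_diff_quadratic m k (alpha : R) T P A a :
  ap_diff_with m k alpha T P A a -> exists C r0, quadratic_on T P C r0.
Proof.
move=> [_ [_ pP] [P0 dP] _ _].
have [C [r [C0 r0 H]]] := polyfun_quadratic pP P0 dP.
exists C, r; split=> // y yT yr.
have := H (enorm y) 0 y yr (mem0v _) yT.
by rewrite enorm0 P0 !subr0 expr2 mulrA; apply => //; exact: enorm_ge0.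
Qed.

(** Condition (1) does not involve the polynomial. For condition (2), [P - P'] is [O(r^(i+1))] on
    the base points that matter, so for small [r] a point farther than [eps r^i] from the new graph
    is farther than [eps / 2 * r^k] from the old one. *)
Lemma ap_diff_trunc m k i (alpha : R) T P A a : (1 <= i <= k)%N ->
  ap_diff_with m k alpha T P A a -> exists P', ap_diff_with m i 0 T P' A a.
Proof.
move=> ik [mn [Po pP] [P0 dP] c1 c2].
have [P' [P'o pP' P'0 dP' [C [r0 [C0 r00 H]]]]] := polyfun_trunc ik pP Po P0 dP.
have bv := ap_cond1_ball_vol c1.
exists P'; split; [exact: mn|by split|by split|exact: c1|split; last by rewrite ltxx].
move=> eps eps0; apply/(density_cvg0P m bv); first by move=> r; exact: hausdorff_ge0.
have e2 : 0 < eps / 2 by rewrite divr_gt0.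
have h2 := ap_cond2_littleo bv c2 e2.
pose M := 1 + eps.
have M0 : 0 < M by rewrite addr_gt0.
pose D := C * M ^+ i.+1 + 1.
have D0 : 0 < D by rewrite ltr_wpDl // mulr_ge0 // exprn_ge0 // ltW.
move=> e e0; near=> r.
have r_gt0 : 0 < r by near: r; exact: near_right_gt0.
have rle1 : r < 1 by near: r; exact: near_right_lt.
have rM : r < r0 / M by near: r; apply: near_right_lt; rewrite divr_gt0.
have rD : r < eps / 4 / D by near: r; apply: near_right_lt; rewrite !divr_gt0.
apply: (@le_trans _ _ (hausdorff m
  (off_graph T P (eps / 2 * r ^+ k) r [set x - a | x in A])));
  last by near: r; exact: h2.
apply: le_hausdorff => x [[A1x xr] /= xg]; split=> //=.
rewrite ltNge; apply/negP => xP; move: xg; apply/negP; rewrite -leNgt.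
have rk0 : 0 < r ^+ k by rewrite exprn_gt0.
have ri0 : 0 < r ^+ i by rewrite exprn_gt0.
have /andP[i1 ilek] := ik.
have rki : r ^+ k <= r ^+ i by apply: ler_wiXn2l => //; exact: ltW.
have ri1 : r ^+ i <= r.
  by rewrite -[leRHS]expr1; apply: ler_wiXn2l => //; exact: ltW.
(* The slack from [eps / 2] to [3 eps / 4] replaces an attained distance; the remaining [eps / 4] is
   for [P - P']. *)
have [|y yT xy] := near_graph (t' := eps * 3 / 4 * r ^+ k) xP.
  by rewrite ltr_pM2r //; move: (eps0); clear; lra.
have yM : enorm y <= M * r.
  apply: le_trans (enorm_graph_base x Po yT) _; rewrite mulrDl mul1r.
  move: xr; rewrite /cballE/= subr0 => xr; apply: lerD => //.
  apply: le_trans (ltW xy) _.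
  apply: (@le_trans _ _ (eps * 3 / 4 * r)).
    by rewrite ler_wpM2l ?(le_trans rki) // divr_ge0 // mulr_ge0 // ltW.
  by rewrite ler_wpM2r ?(ltW r_gt0) //; move: (eps0); clear; lra.
have yr0 : enorm y < r0.
  by apply: le_lt_trans yM _; rewrite mulrC -ltr_pdivlMr.
have PP' : enorm (P y - P' y) <= eps / 4 * r ^+ i.
  apply: le_trans (H y yT yr0) _.
  apply: (@le_trans _ _ (C * (M * r) ^+ i.+1)).
    by rewrite ler_wpM2l // lerXn2r ?nnegrE ?enorm_ge0 // mulr_ge0 // ltW.
  rewrite exprMn exprS mulrA [r ^+ i.+1]exprS mulrA -exprS.
  rewrite ler_wpM2r ?(ltW ri0) //.
  apply: (@le_trans _ _ (D * r)).
    by rewrite ler_wpM2r ?(ltW r_gt0) // lerDl.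
  by rewrite mulrC -ler_pdivlMr // ltW.
apply: le_trans (edistE_graph_le P' x yT) _; rewrite lee_fin.
have -> : x - (y + P' y) = (x - (y + P y)) + (P y - P' y).
  by apply/rowP => j; rewrite !mxE; ring.
apply: le_trans (enormD _ _) _.
apply: (@le_trans _ _ (eps * 3 / 4 * r ^+ i + eps / 4 * r ^+ i)); last by clear; lra.
apply: lerD => //; apply: le_trans (ltW xy) _.
by rewrite ler_wpM2l // divr_ge0 // mulr_ge0 // ltW.
Unshelve. all: by end_near. Qed.

(** If [z] in [T] had a component of length [d > 0] normal to [T'], the part of [A] in a cylinder
    about [r z] would stay at distance comparable to [d r] from the graph of [P'], as [P'] is
    quadratic. It would lie in the exceptional set for [T'], whose [m']-measure is [o(r^m')]: too
    little if [m' = m], and forcing [m]-measure zero if [m' < m]. *)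
Lemma ap_tan_sub m m' T T' P P' A a : (m' <= m)%N ->
  ap_diff_with m 1 0 T P A a -> ap_diff_with m' 1 0 T' P' A a -> (T <= T')%VS.
Proof.
move=> m'm [_ _ _ c1 _] ap'; have [_ [Po' _] _ c1' c2'] := ap'.
have [C [r0 [C0 r00 Q]]] := ap_diff_quadratic ap'.
have bv := ap_cond1_ball_vol c1; have bv' := ap_cond1_ball_vol c1'.
set A1 := [set x - a | x in A] in c1 c1' c2'.
apply/subvP => z zT; apply/negPn/negP => zT'.
pose L := enorm z; pose d := enorm (orthproj (orthv T') z).
have d0 : 0 < d.
  apply: enorm_gt0; apply: contra zT' => /eqP; exact: orthprojv_eq0.
have dL : d <= L by exact: enorm_orthproj.
have L0 : 0 < L := lt_le_trans d0 dL.
pose eps := d / (4 * L).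
have eps0 : 0 < eps by rewrite divr_gt0 // mulr_gt0.
have epsL : eps * L = d / 4 by rewrite /eps; field; rewrite gt_eqF.
have [eta eta0 H1] := ap_cond1_near c1 eps0.
pose e := d / (16 * L).
have e0 : 0 < e by rewrite divr_gt0 // mulr_gt0.
have H2 := ap_cond2_littleo bv' c2' e0.
(* For equal dimensions [f (2 L r)^m] is half of the lower bound [eta (L r)^m]; otherwise only
   finiteness matters. *)
pose f := if m' == m then eta / 2 ^+ m.+1 else 1.
have f0 : 0 < f by rewrite /f; case: ifP => // _; rewrite divr_gt0 // exprn_gt0.
have L20 : 0 < 2 * L by rewrite mulr_gt0.
have D0 : 0 < C * (3 * L) ^+ 2 + 1.
  by rewrite ltr_wpDl // mulr_ge0 // exprn_ge0 // mulr_ge0 // ltW.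
have {}H1 := near_rightM L0 H1.
have {f0}H2 := near_rightM L20 (H2 f f0).
suff /filter_ex[//] : \forall r \near (0 : R)^'+, False.
near=> r.
have r_gt0 : 0 < r by near: r; exact: near_right_gt0.
have H1z : ((eta * (L * r) ^+ m)%:E <=
   hausdorff m (cyl T (r *: z) (eps * (L * r)) (eps * (L * r)) `&` A1))%E.
  have H1r : forall z0 : V, z0 \in T -> enorm z0 <= L * r ->
    ((eta * (L * r) ^+ m)%:E <=
      hausdorff m (cyl T z0 (eps * (L * r)) (eps * (L * r)) `&` A1))%E by near: r.
  apply: H1r; first exact: memvZ.
  by rewrite enormZ gtr0_norm // mulrC.
have H2r : (hausdorff m' (off_graph T' P' (e * (2 * L * r) ^+ 1) (2 * L * r) A1)
   <= (f * (2 * L * r) ^+ m')%:E)%E by near: r.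
have rr0 : r < r0 / (3 * L).
  by near: r; apply: near_right_lt; rewrite divr_gt0 // mulr_gt0.
have rD : r < d / 8 / (C * (3 * L) ^+ 2 + 1).
  by near: r; apply: near_right_lt; rewrite !divr_gt0.
set r' := 2 * L * r in H2r.
have r'0 : 0 < r' by rewrite !mulr_gt0.
have sub : cyl T (r *: z) (eps * (L * r)) (eps * (L * r)) `&` A1
    `<=` off_graph T' P' (e * r' ^+ 1) r' A1.
  move=> x [cx Ax].
  have xz : enorm (x - r *: z) <= d / 2 * r.
    apply: le_trans (enorm_cyl cx) _; rewrite mulrA epsL; clear; lra.
  have xr' : enorm x <= r'.
    apply: le_trans (le_enorm_add x (r *: z)) _.
    rewrite enormZ gtr0_norm // -/L /r'.
    have : d / 2 * r <= L * r by rewrite ler_wpM2r ?(ltW r_gt0) //; move: (dL) (d0); clear; lra.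
    move: xz; clear; lra.
  split; first by split=> //; rewrite /cballE/= subr0.
  rewrite /= ltNge; apply/negP => xP.
  have er'E : e * r' ^+ 1 = d / 8 * r.
    by rewrite expr1 /e /r'; field; rewrite gt_eqF.
  rewrite er'E in xP.
  have [|y yT xy] := near_graph (t' := d / 4 * r) xP.
    by rewrite ltr_pM2r //; move: (d0); clear; lra.
  have y2 : enorm y <= 3 * L * r.
    apply: le_trans (enorm_graph_base x Po' yT) _.
    have : d / 4 * r <= L * r by rewrite ler_wpM2r ?(ltW r_gt0) //; move: (dL) (d0); clear; lra.
    move: xr' xy; rewrite /r'; clear; lra.
  have yr0 : enorm y < r0.
    by apply: le_lt_trans y2 _; rewrite mulrC -ltr_pdivlMr // mulr_gt0.
  have Py : enorm (P' y) <= d / 8 * r.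
    apply: le_trans (Q y yT yr0) _.
    apply: (@le_trans _ _ (C * (3 * L * r) ^+ 2)).
      rewrite ler_wpM2l // lerXn2r ?nnegrE ?enorm_ge0 //.
      by rewrite !mulr_ge0 // ltW.
    rewrite exprMn mulrA expr2 mulrA ler_wpM2r ?(ltW r_gt0) //.
    apply: (@le_trans _ _ ((C * (3 * L) ^+ 2 + 1) * r)).
      by rewrite ler_wpM2r ?(ltW r_gt0) // lerDl.
    by rewrite mulrC -ler_pdivlMr // ltW.
  have := enorm_orthv_graph x Po' yT.
  have := le_enorm_add (orthproj (orthv T') (r *: z)) (orthproj (orthv T') x).
  rewrite -orthprojB orthprojZ enormZ gtr0_norm // -/d.
  have := enorm_orthproj (orthv T') (r *: z - x); rewrite (enormBC (r *: z) x).
  have : 0 < d * r by rewrite mulr_gt0.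
  move: xz xy Py; clear; lra.
have pos : (0 < hausdorff m (cyl T (r *: z) (eps * (L * r)) (eps * (L * r))
    `&` A1))%E.
  by apply: lt_le_trans H1z; rewrite lte_fin mulr_gt0 // exprn_gt0 // mulr_gt0.
have [mE|mN] := eqVneq m' m; last first.
  have : (0 < hausdorff m (off_graph T' P' (e * r' ^+ 1) r' A1))%E.
    exact: lt_le_trans pos (le_hausdorff _ sub).
  rewrite (@hausdorff_dim_eq0 _ _ m m') ?ltxx //; first by rewrite ltn_neqAle mN.
  by apply: le_lt_trans H2r _; rewrite ltry.
move: H2r; rewrite mE => H2m.
have := le_trans H1z (le_trans (le_hausdorff m sub) H2m).
apply/negP; rewrite lee_fin -ltNge /f mE eqxx.
have -> : r' = 2 * (L * r) by rewrite /r' mulrA.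
rewrite exprMn exprS.
have X : 0 < eta * (L * r) ^+ m by rewrite mulr_gt0 // exprn_gt0 // mulr_gt0.
rewrite [ltLHS](_ : _ = eta * (L * r) ^+ m / 2); first by move: (X); clear; lra.
by field; rewrite expf_neq0.
Unshelve. all: by end_near. Qed.

(** The data are cut down to order 1, where the choice is made. The inclusion is known only from the
    plane of larger or equal dimension into the other, which already forces equality. *)
Lemma apTan_eq m k (alpha : R) T P A a : (1 <= k)%N ->
  ap_diff_with m k alpha T P A a -> apTan A a = T.
Proof.
move=> k1 apd; have [P1 ap1] := ap_diff_trunc (i := 1) (k1 : (1 <= 1 <= k)%N) apd.
rewrite /apTan; case: xgetP => [T' _ [m' [P' ap']]|/(_ T)[]]; last by exists m, P1.
have [[_ dT] _ _ _ _] := ap1; have [[_ dT'] _ _ _ _] := ap'.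
have [m'm|/ltnW mm'] := leqP m' m.
  have s := ap_tan_sub m'm ap1 ap'.
  by apply/eqP; rewrite eq_sym eqEdim s dT dT'.
have s := ap_tan_sub mm' ap' ap1.
by apply/eqP; rewrite eqEdim s dT dT'.
Qed.

End ApproximateTangent.

(** * Construction of B *)

Section Gauge.
Context {R : realType}.

Lemma exists_invn_le (e : R) : 0 < e -> exists N : nat, N.+1%:R^-1 <= e.
Proof.
move=> e0; exists (Num.bound e^-1).
rewrite -[leRHS]invrK lef_pV2 ?posrE ?invr_gt0 //.
apply: le_trans (ltW (archi_boundP _)) _; first by rewrite invr_ge0 ltW.
by rewrite ler_nat.
Qed.

(* A diagonal choice; [w r] is the inverse of the least [j] such that
   [s j <= r], where [G (1 / (j + 1))] holds below [s j]. *)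
Lemma diagonal_gauge (G : R -> R -> Prop) :
  (forall e : R, 0 < e -> \forall r \near (0 : R)^'+, G e r) ->
  exists w s0, [/\ 0 < s0, (forall r, 0 <= w r),
    (forall r s, 0 < r -> r <= s -> s < s0 -> w r <= w s),
    (\forall r \near (0 : R)^'+, G (w r) r) &
    forall e : R, 0 < e -> \forall r \near (0 : R)^'+, w r <= e].
Proof.
move=> H.
have /choice[s sP] (j : nat) : exists s : R, [/\ 0 < s, s <= j.+1%:R^-1 &
    forall r, 0 < r -> r < s -> G j.+1%:R^-1 r].
  have ej : 0 < j.+1%:R^-1 :> R by rewrite invr_gt0 ltr0Sn.
  have /at_rightP[d d0 Hd] := H _ ej.
  exists (Num.min d j.+1%:R^-1); split.
  - by rewrite lt_min d0 invr_gt0 ltr0Sn.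
  - by rewrite ge_min lexx orbT.
  - by move=> r r0; rewrite lt_min => /andP[rd _]; apply: Hd; rewrite ?invr_gt0.
have s_gt0 j : 0 < s j by case: (sP j).
have /choice[K KP] (r : R) : exists K : nat,
    0 < r -> s K <= r /\ forall j, (j < K)%N -> r < s j.
  have [r0|] := ltP 0 r; last by exists 0%N.
  have [N Nr] := exists_invn_le r0.
  have ex : exists j, s j <= r.
    by exists N; apply: le_trans Nr; case: (sP N).
  case: (ex_minnP ex) => K sK Kmin; exists K => _; split=> // j jK.
  by rewrite ltNge; apply/negP => /Kmin; rewrite leqNgt jK.
have K1 r : 0 < r -> r < s 0%N -> (0 < K r)%N.
  move=> r0 rs; rewrite lt0n; apply/eqP => Kr0; have [] := KP r r0.
  by rewrite Kr0 leNgt rs.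
(* For [r >= s 0] the index is 0 and its inverse is 0 by convention, so monotonicity is claimed only
   below [s 0]. *)
exists (fun r => (K r)%:R^-1), (s 0%N); split=> //.
- move=> r t r0 rt ts; have t0 := lt_le_trans r0 rt.
  rewrite lef_pV2 ?posrE ?ltr0n ?K1 ?(le_lt_trans rt) // ler_nat leqNgt.
  apply/negP => Krt; have [_ /(_ _ Krt)] := KP t t0.
  by have [/le_trans/(_ rt)] := KP r r0; rewrite leNgt => /negbTE ->.
- apply/at_rightP; exists (s 0%N) => // r r0 rs.
  (* [w r] is the parameter of index [K r - 1], and [r < s (K r - 1)] by minimality of [K r]. *)
  have Kr := K1 r r0 rs; have [_ KPr] := KP r r0.
  have := sP (K r).-1; rewrite prednK // => -[_ _]; apply => //.
  by apply: KPr; rewrite prednK.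
move=> e e0; have [N Ne] := exists_invn_le e0.
apply/at_rightP; exists (\big[Num.min/1]_(j < N.+1) s j).
  by apply/bigmin_gtP; split.
move=> r r0 /bigmin_gtP[_ rs]; apply: le_trans Ne.
have NK : (N < K r)%N.
  rewrite ltnNge; apply/negP => KN; have [] := KP r r0.
  by rewrite leNgt (rs (Ordinal (KN : K r < N.+1)%N)).
by rewrite lef_pV2 ?posrE ?ltr0n ?(leq_trans _ NK) // ler_nat.
Qed.

Lemma powR_le_near (alpha e : R) : 0 < alpha -> 0 < e ->
  \forall r \near (0 : R)^'+, r `^ alpha <= e.
Proof.
move=> a0 e0; apply/at_rightP; exists (e `^ alpha^-1); first exact: powR_gt0.
move=> r r0 re.
have -> : e = (e `^ alpha^-1) `^ alpha.
  by rewrite -powRrM mulVf ?gt_eqF // powRr1 // ltW.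
by apply: ge0_ler_powR; rewrite ?nnegrE ?ltW // powR_gt0.
Qed.

End Gauge.

(** * The gauge of condition (2) and the removal of the bad points *)

Section GoodSubset.
Context {R : realType} {n : nat}.
Local Notation V := 'rV[R]_n.
Implicit Types (A : set V) (a x y z : V) (T : {vspace V}) (P : V -> V).

Lemma exists_gauge m k (alpha : R) T P A : 0 < ball_vol m :> R -> 0 <= alpha ->
  ap_cond2 m k alpha T P A ->
  exists h s0, [/\ 0 < s0, (forall r, 0 <= r -> 0 <= h r),
    (forall r s, 0 < r -> r <= s -> s < s0 -> h r <= h s),
    right_littleo m (fun r => hausdorff m (off_graph T P (h r) r A)) &
    (forall e : R, 0 < e -> \forall r \near (0 : R)^'+, h r <= e * r ^+ k) /\
    (0 < alpha -> exists2 C : R, 0 <= C &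
       forall r, 0 <= r -> h r <= C * r `^ (k%:R + alpha))].
Proof.
move=> bv; rewrite le_eqVlt => /predU1P[<-|a0] c2.
  (* One parameter bounds both the width of the neighbourhood and the measure outside it, so a
     single diagonal choice makes both tend to 0. *)
  pose G (e r : R) := (hausdorff m (off_graph T P (e * r ^+ k) r A) <= (e * r ^+ m)%:E)%E.
  have [|w [s0 [s00 w0 wm Gw wo]]] := @diagonal_gauge _ G.
    by move=> e e0; exact: (ap_cond2_littleo bv c2 e0 e0).
  exists (fun r => w r * r ^+ k), s0; split=> //.
  - by move=> r r0; rewrite mulr_ge0 // exprn_ge0.
  - move=> r s r0 rs ss0; apply: ler_pM; rewrite ?exprn_ge0 ?(ltW r0) //.
      exact: wm.
    by rewrite lerXn2r // nnegrE ltW // (lt_le_trans r0).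
  - move=> e e0; near=> r.
    have Gr : G (w r) r by near: r; exact: Gw.
    apply: le_trans Gr _; rewrite lee_fin ler_wpM2r //.
      by rewrite exprn_ge0 // ltW //; near: r; exact: near_right_gt0.
    by near: r; exact: wo.
  - split=> [e e0|]; last by rewrite ltxx.
    near=> r; rewrite ler_wpM2r //.
      by rewrite exprn_ge0 // ltW //; near: r; exact: near_right_gt0.
    by near: r; exact: wo.
have [_ /(_ a0)[lam [lam0 lim]]] := c2.
have ka0 : 0 <= k%:R + alpha by rewrite addr_ge0 // ltW.
exists (fun r => lam * r `^ (k%:R + alpha)), 1; split=> //.
- by move=> r r0; rewrite mulr_ge0 // powR_ge0.
- move=> r s r0 rs _; rewrite ler_wpM2l // ge0_ler_powR // nnegrE ltW //.
  exact: lt_le_trans rs.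
- by apply/(density_cvg0P m bv) => // r; exact: hausdorff_ge0.
have l1 : 0 < lam + 1 by rewrite ltr_wpDl.
split=> [e e0|_]; last by exists lam.
near=> r; have r0 : 0 < r by near: r; exact: near_right_gt0.
rewrite powRD; last by rewrite (gt_eqF r0) implybT.
rewrite powR_mulrn ?(ltW r0) // mulrCA mulrC ler_wpM2r ?exprn_ge0 ?(ltW r0) //.
apply: (@le_trans _ _ ((lam + 1) * r `^ alpha)).
  by rewrite ler_wpM2r ?powR_ge0 // lerDl.
rewrite mulrC -ler_pdivlMr //.
by near: r; apply: powR_le_near => //; exact: divr_gt0.
Unshelve. all: by end_near. Qed.

(** On the annulus [r / 2^(i+1) < |x| <= r / 2^i] one has [r / 2^i <= 2 |x|], so a point farther
    than [h (2 |x|)] from the graph is exceptional at scale [r / 2^i]; this is the reason for the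
    factor 2. The bounds form a geometric series since [m > 0], and the origin is never bad because
    it lies on the graph. *)
Lemma excess_littleo m T P A (h : R -> R) (s0 : R) : (0 < m)%N ->
  P 0 = 0 -> 0 < s0 -> (forall r, 0 <= r -> 0 <= h r) ->
  (forall r s, 0 < r -> r <= s -> s < s0 -> h r <= h s) ->
  right_littleo m (fun r => hausdorff m (off_graph T P (h r) r A)) ->
  right_littleo m (fun r => hausdorff m
    ([set x | A x /\ ((h (2 * enorm x))%:E < edistE (gr T P) x)%E] `&` cballE 0 r)).
Proof.
move=> m0 P0 s00 h0 hm ho e e0.
have /at_rightP[d d0 H] := ho _ (divr_gt0 e0 (ltr0Sn R 1)).
(* Half of [s0], because monotonicity of [h] is used up to [2 |x| <= 2 r]. *)
apply/at_rightP; exists (Num.min d (s0 / 2)).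
  by rewrite lt_min d0 divr_gt0.
move=> r r0; rewrite lt_min => /andP[rd rs].
pose F (i : nat) := off_graph T P (h (r / 2 ^+ i)) (r / 2 ^+ i) A.
have ri0 i : 0 < r / 2 ^+ i by rewrite divr_gt0 // exprn_gt0.
have rir i : r / 2 ^+ i <= r.
  by rewrite ler_pdivrMr ?exprn_gt0 // ler_peMr ?(ltW r0) // exprn_ege1 // ler1n.
apply: (@le_trans _ _ (hausdorff m (\bigcup_i F i))).
  apply: le_hausdorff => x [[Ax xh]]; rewrite /cballE/= subr0 => xr.
  have x0 : 0 < enorm x.
    rewrite enorm_gt0 //; apply/eqP => x0; move: xh; apply/negP; rewrite -leNgt.
    apply: le_trans (edistE_graph_le P x (mem0v T)) _.
    rewrite lee_fin P0 addr0 subr0 x0 enorm0; exact: h0.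
  have ex : exists i, r / 2 ^+ i.+1 < enorm x.
    have [N Nx] := exists_invn_le (divr_gt0 x0 r0); exists N.
    apply: (@lt_le_trans _ _ (r / N.+1%:R)).
      rewrite ltr_pM2l // ltf_pV2 ?posrE ?exprn_gt0 // -natrX ltr_nat.
      exact: ltn_expl.
    by rewrite mulrC -ler_pdivlMr.
  case: (ex_minnP ex) => i xi imin; exists i => //.
  have xri : enorm x <= r / 2 ^+ i.
    case: i xi imin => [|i] xi imin; first by rewrite expr0 divr1.
    by rewrite leNgt; apply/negP => /imin; rewrite ltnn.
  split; first by split=> //; rewrite /cballE/= subr0.
  rewrite /=; apply: le_lt_trans xh; rewrite lee_fin; apply: hm => //.
    have -> : r / 2 ^+ i = 2 * (r / 2 ^+ i.+1).
      by rewrite exprS; field; rewrite expf_neq0.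
    by rewrite ler_pM2l // ltW.
  rewrite mulrC -ltr_pdivlMr //; exact: le_lt_trans rs.
apply: le_trans (hausdorff_bigcup m F) _.
apply: (@le_trans _ _ (\sum_(i <oo) ((e * r ^+ m) / (2 ^ i.+1)%:R)%:E)%E); last first.
  by apply: epsilon_trick0; rewrite mulr_ge0 ?exprn_ge0 ?ltW.
apply: lee_nneseries => [i _ _|i _]; first exact: hausdorff_ge0.
apply: le_trans (H _ (ri0 i) (le_lt_trans (rir i) rd)) _.
rewrite lee_fin natrX exprS invfM -!mulrA ler_pM2l //.
rewrite mulrCA ler_pM2l ?invr_gt0 // expr_div_n ler_pM2l ?exprn_gt0 //.
rewrite lef_pV2 ?posrE ?exprn_gt0 // -exprM.
by apply: ler_weXn2l; rewrite ?ler1n // leq_pmulr.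
Qed.

Lemma good_subset m k (alpha : R) T P A a : 0 <= alpha -> (0 < k)%N ->
  ap_diff_with m k alpha T P A a ->
  exists B : set V, [/\ B `<=` [set x - a | x in A],
    right_littleo m (fun r =>
      hausdorff m (([set x - a | x in A] `\` B) `&` cballE 0 r)),
    (forall e : R, 0 < e -> exists2 d : R, 0 < d & forall b, B b -> enorm b < d ->
      (edistE (gr T P) b <= (e * enorm b ^+ k)%:E)%E) &
    (0 < alpha -> exists2 C : R, 0 <= C & forall b, B b ->
      (edistE (gr T P) b <= (C * enorm b `^ (k%:R + alpha))%:E)%E)].
Proof.
move=> a0 k0 [[/andP[m0 _] _] _ [P0 _] c1 c2].
have bv := ap_cond1_ball_vol c1.
have [h [s0 [s00 h0 hm ho [hk ha]]]] := exists_gauge bv a0 c2.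
set A1 := [set x - a | x in A] in c1 c2 ho *.
exists [set x | A1 x /\ (edistE (gr T P) x <= (h (2 * enorm x))%:E)%E].
split=> [x []//|e e0|e e0|/ha[C C0 hC]].
- apply: filterS (excess_littleo m0 P0 s00 h0 hm ho e0) => r; apply: le_trans.
  apply: le_hausdorff => x [[Ax Bx] xr]; split=> //; split=> //.
  by rewrite ltNge; apply/negP => xh; exact: Bx.
(* Division by [2^k] compensates for the gauge being evaluated at [2 |b|]. *)
- have /at_rightP[d d0 H] := hk _ (divr_gt0 e0 (exprn_gt0 k (ltr0Sn R 1))).
  exists (d / 2); first exact: divr_gt0.
  move=> b [_ bh] bd; have [->|b0] := eqVneq b 0.
    apply: le_trans (edistE_graph_le P 0 (mem0v T)) _.
    by rewrite lee_fin P0 addr0 subr0 enorm0 expr0n gtn_eqF // mulr0.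
  apply: le_trans bh _; rewrite lee_fin.
  have bgt := enorm_gt0 b0.
  apply: le_trans (H (2 * enorm b) _ _) _.
  - by rewrite mulr_gt0.
  - by rewrite mulrC -ltr_pdivlMr.
  rewrite exprMn mulrA divfK ?expf_neq0 //.
exists (C * 2 `^ (k%:R + alpha)); first by rewrite mulr_ge0 // powR_ge0.
move=> b [_ bh]; apply: le_trans bh _; rewrite lee_fin.
apply: le_trans (hC _ _) _; first by rewrite mulr_ge0 // enorm_ge0.
by rewrite powRM ?enorm_ge0 // mulrA.
Qed.

End GoodSubset.

(** * Pointwise differentiability of B *)

Section GoodSubsetFacts.
Context {R : realType} {n : nat}.
Local Notation V := 'rV[R]_n.
Implicit Types (m k : nat) (T : {vspace V}) (P : V -> V) (A B : set V).

(* [A] is understood to be translated so that the base point is the origin. *)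
Record good m k T P A B : Prop := Good {
  good_m : (0 < m)%N;
  good_k : (0 < k)%N;
  good_orth : maps_to_orth T P;
  good_P0 : P 0 = 0;
  good_quadratic : exists C r0, quadratic_on T P C r0;
  good_cond1 : ap_cond1 m T A;
  good_sub : B `<=` A;
  good_compl : right_littleo m (fun r => hausdorff m ((A `\` B) `&` cballE 0 r));
  good_edist : forall e : R, 0 < e -> exists2 d : R, 0 < d &
    forall b, B b -> enorm b < d -> (edistE (gr T P) b <= (e * enorm b ^+ k)%:E)%E
}.

(** A cylinder about [z] with [|z| <= r] lies in the ball of radius [(1 + 2 eps) r], where [A \ B]
    has measure at most [eta / 2 * r^m]; by subadditivity half of the bound for [A] is left for
    [B]. *)
Lemma good_cyl m k T P A B (eps : R) :
  good m k T P A B -> 0 < eps -> exists2 eta : R, 0 < eta &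
  \forall r \near (0 : R)^'+, forall z, z \in T -> enorm z <= r ->
    ((eta * r ^+ m)%:E <= hausdorff m (cyl T z (eps * r) (eps * r) `&` B))%E.
Proof.
move=> G; have [m_gt0 k_gt0 Po P0 PQ c1 BA AB BP] := G.
move=> eps0; have [eta eta0 H] := ap_cond1_near c1 eps0.
pose M := 1 + 2 * eps; have M0 : 0 < M by rewrite addr_gt0 // mulr_gt0.
have e0 : 0 < eta / 2 / M ^+ m by rewrite !divr_gt0 // exprn_gt0.
have H2 := near_rightM M0 (AB _ e0).
exists (eta / 2); first by rewrite divr_gt0.
near=> r; have r0 : 0 < r by near: r; exact: near_right_gt0.
have H1r : forall z, z \in T -> enorm z <= r ->
    ((eta * r ^+ m)%:E <= hausdorff m (cyl T z (eps * r) (eps * r) `&` A))%E.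
  by near: r.
have H2r : (hausdorff m ((A `\` B) `&` cballE 0 (M * r)) <=
    (eta / 2 / M ^+ m * (M * r) ^+ m)%:E)%E by near: r.
move=> z zT zr; have := H1r z zT zr.
have sub : cyl T z (eps * r) (eps * r) `&` A `<=`
    (cyl T z (eps * r) (eps * r) `&` B) `|` ((A `\` B) `&` cballE 0 (M * r)).
  move=> x [cx Ax]; have [Bx|Bx] := pselect (B x); first by left.
  right; split=> //; rewrite /cballE/= subr0.
  apply: le_trans (le_enorm_add x z) _; rewrite /M mulrDl mul1r.
  apply: lerD => //; apply: le_trans (enorm_cyl cx) _.
  by rewrite -mulrA mulrDl mul1r.
move=> /le_trans/(_ (le_hausdorff m sub))/le_trans/(_ (hausdorffU _ _ _)).
move=> /le_trans/(_ (leeD2l _ H2r)).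
have -> : (eta / 2 / M ^+ m * (M * r) ^+ m = eta / 2 * r ^+ m)%R.
  by rewrite exprMn mulrA divfK // expf_neq0 ?gt_eqF.
rewrite [X in (X%:E <= _)%E](_ : _ = eta / 2 * r ^+ m + eta / 2 * r ^+ m).
  by rewrite EFinD leeD2rE.
by rewrite -mulrDl -splitr.
Unshelve. all: by end_near. Qed.

Lemma good_dense m k T P A B (eps : R) :
  good m k T P A B -> 0 < eps -> \forall r \near (0 : R)^'+,
  forall z, z \in T -> enorm z <= r -> exists2 b, B b & enorm (b - z) <= eps * r.
Proof.
move=> G; have [m_gt0 k_gt0 Po P0 PQ c1 BA AB BP] := G.
move=> eps0; have [eta eta0 H] := good_cyl G (divr_gt0 eps0 (ltr0Sn R 1)).
near=> r; have r0 : 0 < r by near: r; exact: near_right_gt0.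
have Hr : forall z, z \in T -> enorm z <= r ->
    ((eta * r ^+ m)%:E <= hausdorff m (cyl T z (eps / 2 * r) (eps / 2 * r) `&` B))%E.
  by near: r.
move=> z zT zr; have := Hr z zT zr.
set X := _ `&` B => HX; have /set0P[b [cb Bb]] : X != set0.
  apply/eqP => X0; move: HX; apply/negP.
  by rewrite X0 hausdorff0 -ltNge lte_fin mulr_gt0 // exprn_gt0.
exists b => //; apply: le_trans (enorm_cyl cb) _.
by rewrite -mulrDl -splitr.
Unshelve. all: by end_near. Qed.

Lemma graph_small T P (e M : R) : (exists C r0, quadratic_on T P C r0) ->
  0 < e -> 0 < M -> \forall r \near (0 : R)^'+,
  forall y, y \in T -> enorm y <= M * r -> enorm (P y) <= e * r.
Proof.
move=> [C [r0 [C0 r00 Q]]] e0 M0.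
have D0 : 0 < C * M ^+ 2 + 1 by rewrite ltr_wpDl // mulr_ge0 // exprn_ge0 // ltW.
near=> r; have r_gt0 : 0 < r by near: r; exact: near_right_gt0.
have rr0 : r < r0 / M by near: r; apply: near_right_lt; rewrite divr_gt0.
have rD : r < e / (C * M ^+ 2 + 1).
  by near: r; apply: near_right_lt; rewrite divr_gt0.
move=> y yT yM; apply: le_trans (Q y yT _) _.
  by apply: le_lt_trans yM _; rewrite mulrC -ltr_pdivlMr.
apply: (@le_trans _ _ (C * (M * r) ^+ 2)).
  rewrite ler_wpM2l // lerXn2r ?nnegrE ?enorm_ge0 //.
  by rewrite mulr_ge0 // ltW.
rewrite exprMn mulrA [r ^+ 2]expr2 mulrA ler_wpM2r ?(ltW r_gt0) //.
apply: (@le_trans _ _ ((C * M ^+ 2 + 1) * r)).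
  by rewrite ler_wpM2r ?(ltW r_gt0) // lerDl.
by rewrite mulrC -ler_pdivlMr // ltW.
Unshelve. all: by end_near. Qed.

Lemma gr0 T P : P 0 = 0 -> gr T P 0.
Proof. by move=> P0; exists 0; rewrite /= ?mem0v // P0 addr0. Qed.

Lemma edist_graph_le T P x : P 0 = 0 ->
  (edistE (gr T P) x <= (enorm x)%:E)%E.
Proof. by move=> P0; have := edistE_le x (gr0 T P0); rewrite subr0. Qed.

Lemma good_edist1 m k T P A B (e : R) :
  good m k T P A B -> 0 < e -> exists2 d : R, 0 < d &
  forall b, B b -> enorm b < d -> (edistE (gr T P) b <= (e * enorm b)%:E)%E.
Proof.
move=> G; have [m_gt0 k_gt0 Po P0 PQ c1 BA AB BP] := G.
move=> e0; have [d d0 H] := BP _ e0; exists (Num.min d 1).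
  by rewrite lt_min d0 ltr01.
move=> b Bb; rewrite lt_min => /andP[bd b1]; apply: le_trans (H b Bb bd) _.
rewrite lee_fin ler_wpM2l ?(ltW e0) // -[leRHS]expr1.
by apply: ler_wiXn2l => //; [exact: enorm_ge0|exact: ltW].
Qed.

(** Points of the graph are close to [B] by density of [B] along [T] and smallness of [P], points of
    [B] are close to the graph by construction. In both cases the points that nearly realise the
    distance from [x] stay within [M r] of the origin, and this fixes [M]. *)
Lemma good_edist_close m k T P A B (eps : R) :
  good m k T P A B -> 0 < eps -> \forall r \near (0 : R)^'+,
  forall x, enorm x <= r ->
    (edistE (gr T P) x <= edistE B x + (eps * r)%:E)%E /\
    (edistE B x <= edistE (gr T P) x + (eps * r)%:E)%E.
Proof.
move=> G; have [m_gt0 k_gt0 Po P0 PQ c1 BA AB BP] := G.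
move=> eps0; pose M := 2 + 2 * eps; have M0 : 0 < M by rewrite addr_gt0 // mulr_gt0.
have e4 : 0 < eps / 4 by rewrite divr_gt0.
have H1 := near_rightM M0 (good_dense G (divr_gt0 e4 M0)).
have H2 := graph_small PQ e4 M0.
have [d d0 H3] := good_edist1 G (divr_gt0 e4 M0).
near=> r; have r0 : 0 < r by near: r; exact: near_right_gt0.
have H1r : forall z, z \in T -> enorm z <= M * r ->
    exists2 b, B b & enorm (b - z) <= eps / 4 / M * (M * r) by near: r.
have H2r : forall y, y \in T -> enorm y <= M * r -> enorm (P y) <= eps / 4 * r.
  by near: r.
have rd : r < d / M by near: r; apply: near_right_lt; rewrite divr_gt0.
move=> x xr; set q := eps * r.
have q0 : 0 < q by rewrite mulr_gt0.
have MrE : M * r = 2 * r + 2 * q by rewrite mulrDl mulrA.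
have e4E : eps / 4 / M * (M * r) = q / 4 by rewrite mulrA divfK ?gt_eqF // /q mulrAC.
have e4E' : eps / 4 * r = q / 4 by rewrite /q mulrAC.
rewrite e4E MrE in H1r; rewrite e4E' MrE in H2r.
have half : (edistE B x <= edistE (gr T P) x + q%:E)%E.
  have grx := edist_graph_le T x P0.
  have gf := edistE_fin_num x (gr0 T P0).
  have [||y yT xy] := near_graph (T := T) (P := P) (x := x)
      (t := fine (edistE (gr T P) x)) (t' := fine (edistE (gr T P) x) + q / 4).
  - by rewrite fineK.
  - by rewrite ltrDl divr_gt0.
  have yMr : enorm y <= 2 * r + 2 * q.
    apply: le_trans (enorm_graph_base x Po yT) _.
    have : fine (edistE (gr T P) x) <= enorm x by rewrite -lee_fin fineK.
    move: xy (xr) (q0); clear; lra.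
  have [b Bb by_] := H1r y yT yMr; have Py := H2r y yT yMr.
  apply: le_trans (edistE_le x Bb) _.
  rewrite -[edistE (gr T P) x]fineK // -EFinD lee_fin.
  have -> : x - b = (x - (y + P y)) + (P y - (b - y)).
    by apply/rowP => j; rewrite !mxE; ring.
  apply: le_trans (enormD _ _) _; have := enormB (P y) (b - y).
  move: xy by_ Py (q0); clear; lra.
split=> //.
(* A point of [B] makes the distance to [B] finite. *)
have [|b0 Bb0 _] := H1r 0 (mem0v _).
  by rewrite enorm0 addr_ge0 // mulr_ge0 // ltW.
have Bf := edistE_fin_num x Bb0.
have [||b Bb xb] := @edistE_le_lt _ _ B x (fine (edistE B x)) (fine (edistE B x) + q / 4).
- by rewrite fineK.
- by rewrite ltrDl divr_gt0.
have bMr : enorm b <= M * r.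
  rewrite MrE; have := le_enorm_add b x; rewrite (enormBC b).
  have : fine (edistE B x) <= enorm x + q.
    rewrite -lee_fin fineK // EFinD; apply: le_trans half _.
    by rewrite leeD2r //; exact: edist_graph_le.
  move: xb (xr) (q0); clear; lra.
have bd : enorm b < d by apply: le_lt_trans bMr _; rewrite mulrC -ltr_pdivlMr.
apply: le_trans (edistE_triangle _ x b) _.
rewrite -[edistE B x]fineK // -EFinD.
apply: le_trans (leeD2r _ (H3 b Bb bd)) _.
rewrite -EFinD lee_fin.
have : eps / 4 / M * enorm b <= q / 4.
  by rewrite -e4E ler_wpM2l // !divr_ge0 // ltW.
move: xb (q0); clear; lra.
Unshelve. all: by end_near. Qed.

(** The distance from [b] to the graph is [o(|b|)] and [P] is quadratic. Hence [B] avoids narrow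
    cones about vectors outside [T], which bounds the upper approximate tangent cone. *)
Lemma good_flat m k T P A B (e : R) :
  good m k T P A B -> 0 < e -> exists2 d : R, 0 < d &
  forall b, B b -> enorm b < d -> enorm (orthproj (orthv T) b) <= e * enorm b.
Proof.
move=> G; have [m_gt0 k_gt0 Po P0 PQ c1 BA AB BP] := G.
move=> e0.
have e4 : 0 < e / 4 by rewrite divr_gt0.
have M0 : 0 < 1 + e by rewrite addr_gt0.
have /at_rightP[d1 d10 H1] := graph_small PQ e4 M0.
have [d2 d20 H2] := good_edist1 G e4.
exists (Num.min d1 d2); first by rewrite lt_min d10.
move=> b Bb; rewrite lt_min => /andP[b1 b2].
have [->|b0] := eqVneq b 0; first by rewrite orthproj0 enorm0 mulr0.
have bgt := enorm_gt0 b0.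
have [|y yT by_] := near_graph (t' := e / 2 * enorm b) (H2 b Bb b2).
  by rewrite ltr_pM2r //; move: (e0); clear; lra.
have ye : enorm y <= (1 + e) * enorm b.
  apply: le_trans (enorm_graph_base b Po yT) _; rewrite mulrDl mul1r lerD2l.
  apply: le_trans (ltW by_) _; rewrite ler_wpM2r ?enorm_ge0 //.
  by move: (e0); clear; lra.
apply: le_trans (enorm_orthv_graph b Po yT) _.
have := H1 (enorm b) bgt b1 y yT ye.
have : 0 < e * enorm b by rewrite mulr_gt0.
move: by_; clear; lra.
Qed.

(** The distance from [r v] to [B] is that to the graph, hence [r] times the distance from [v] to
    [T], up to [o(r)]. As the quotient has a genuine limit, both tangent cones are read off at once:
    they consist of the [v] for which it is 0. *)
Lemma good_tan_dist m k T P A B v (e : R) :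
  good m k T P A B -> 0 < e -> \forall r \near (0 : R)^'+,
  ((enorm (orthproj (orthv T) v) - e)%:E <= (r^-1)%:E * edistE B (r *: v)
     <= (enorm (orthproj (orthv T) v) + e)%:E)%E.
Proof.
move=> G; have [m_gt0 k_gt0 Po P0 PQ c1 BA AB BP] := G.
move=> e0; set d := enorm (orthproj (orthv T) v).
pose L := enorm v + 1; have L0 : 0 < L by rewrite ltr_wpDl ?enorm_ge0.
have e4 : 0 < e / 4 by rewrite divr_gt0.
have H1 := near_rightM L0 (good_edist_close G (divr_gt0 e4 L0)).
have M0 : 0 < 2 * enorm v + e by rewrite ltr_wpDl // mulr_ge0 // enorm_ge0.
have H2 := graph_small PQ e4 M0.
near=> r; have r0 : 0 < r by near: r; exact: near_right_gt0.
have H1r : forall x, enorm x <= L * r ->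
    (edistE (gr T P) x <= edistE B x + (e / 4 / L * (L * r))%:E)%E /\
    (edistE B x <= edistE (gr T P) x + (e / 4 / L * (L * r))%:E)%E by near: r.
have H2r : forall y, y \in T -> enorm y <= (2 * enorm v + e) * r ->
    enorm (P y) <= e / 4 * r by near: r.
have rvE : enorm (r *: v) = r * enorm v by rewrite enormZ gtr0_norm.
have rvL : enorm (r *: v) <= L * r.
  by rewrite rvE mulrC ler_wpM2r ?(ltW r0) // lerDl.
have := H1r _ rvL.
rewrite [e / 4 / L * _]mulrA divfK ?gt_eqF //.
set q := e * r; have -> : e / 4 * r = q / 4 by rewrite /q mulrAC.
have e4E : e / 4 * r = q / 4 by rewrite /q mulrAC.
have q0 : 0 < q by rewrite mulr_gt0.
have gf := edistE_fin_num (r *: v) (gr0 T P0).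
set D := fine (edistE (gr T P) (r *: v)).
have DE : edistE (gr T P) (r *: v) = D%:E by rewrite fineK.
rewrite DE => -[h1 h2].
have Bf : edistE B (r *: v) \is a fin_num.
  by rewrite ge0_fin_numE ?edistE_ge0 //; apply: le_lt_trans h2 _; rewrite -EFinD ltry.
set D' := fine (edistE B (r *: v)).
have D'E : edistE B (r *: v) = D'%:E by rewrite fineK.
rewrite D'E -!EFinD !lee_fin in h1 h2 *.
have rdE : enorm (orthproj (orthv T) (r *: v)) = r * d.
  by rewrite orthprojZ enormZ gtr0_norm.
have up : D <= r * d + q / 4.
  rewrite -lee_fin -DE.
  have yT : orthproj T (r *: v) \in T by exact: orthproj_mem.
  apply: le_trans (edistE_graph_le P _ yT) _; rewrite lee_fin opprD addrA.
  apply: le_trans (enormB _ _) _; rewrite -orthproj_orthv rdE lerD2l -e4E.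
  apply: H2r => //; apply: le_trans (enorm_orthproj _ _) _.
  rewrite rvE mulrC ler_wpM2r ?(ltW r0) //; have := enorm_ge0 v.
  by move: (e0); clear; lra.
have lo : r * d <= D + q / 2.
  have [||y yT xy] := near_graph (T := T) (P := P) (x := r *: v) (t := D) (t' := D + q / 4).
  - by rewrite DE.
  - by rewrite ltrDl divr_gt0.
  have DL : D <= r * enorm v by rewrite -lee_fin -DE -rvE; exact: edist_graph_le.
  have yM : enorm y <= (2 * enorm v + e) * r.
    apply: le_trans (enorm_graph_base (r *: v) Po yT) _; rewrite rvE mulrDl -/q.
    by move: DL xy (q0); clear; lra.
  have := enorm_orthv_graph (r *: v) Po yT; rewrite rdE.
  have := H2r y yT yM; rewrite e4E.
  by move: xy; clear; lra.
rewrite [r^-1 * _]mulrC ler_pdivlMr // ler_pdivrMr //.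
rewrite mulrBl mulrDl (mulrC d) -/q.
apply/andP; move: up lo h1 h2 (q0); clear; split; lra.
Unshelve. all: by end_near. Qed.

End GoodSubsetFacts.

(** * The submanifold, the tangent cones and the density at the base point *)

Section PointwiseDifferentiable.
Context {R : realType} {n : nat}.
Local Notation V := 'rV[R]_n.
Implicit Types (m k : nat) (T : {vspace V}) (P : V -> V) (A B : set V) (a v : V).

Local Notation tr a B := [set a + x | x in B].

Lemma le_hausdorff_shift m a A B : (forall x, A x -> B (a + x)) ->
  (hausdorff m A <= hausdorff m B)%E.
Proof.
move=> AB; rewrite -(hausdorff_shift m a A).
by apply: le_hausdorff => _ [x Ax <-]; exact: AB.
Qed.

Lemma le_scaled_inv (c : R) (x y : \bar R) : 0 < c ->
  (x <= c%:E * y)%E -> ((c^-1)%:E * x <= y)%E.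
Proof. by move=> c0 h; rewrite lee_pdivrMl. Qed.

Lemma good_pt_cond m k (alpha : R) T P A B a : good m k T P A B ->
  (0 < alpha -> exists2 C : R, 0 <= C & forall b, B b ->
     (edistE (gr T P) b <= (C * enorm b `^ (k%:R + alpha))%:E)%E) ->
  pt_cond k alpha (tr a (gr T P)) (tr a B) a.
Proof.
move=> G HC; have [m_gt0 k_gt0 Po P0 PQ c1 BA AB BP] := G.
(* The supremum over an empty set is [-oo] and the distance to one is [+oo]; points of [B] in small
   balls exclude both. *)
have ne : \forall r \near (0 : R)^'+, exists2 b, B b & enorm b <= r.
  near=> r; have r0 : 0 < r by near: r; exact: near_right_gt0.
  have H : forall z, z \in T -> enorm z <= r -> exists2 b, B b & enorm (b - z) <= 1 * r.
    by near: r; exact: (good_dense G ltr01).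
  have [|b Bb] := H 0 (mem0v T); first by rewrite enorm0 ltW.
  by rewrite subr0 mul1r; exists b.
split.
- apply: cvg_right => e e0; near=> r.
  have r0 : 0 < r by near: r; exact: near_right_gt0.
  have [b Bb br] : exists2 b, B b & enorm b <= r by near: r; exact: ne.
  have H : forall x, enorm x <= r ->
    (edistE (gr T P) x <= edistE B x + (e * r)%:E)%E /\
    (edistE B x <= edistE (gr T P) x + (e * r)%:E)%E.
    by near: r; exact: (good_edist_close G e0).
  rewrite !add0r; apply/andP; split.
    apply: (@le_trans _ _ 0%E); first by rewrite lee_fin oppr_le0 ltW.
    apply: mule_ge0; first by rewrite lee_fin invr_ge0 ltW.
    apply: le_ereal_sup_tmp; exists `|edistE (tr a (gr T P)) a - edistE (tr a B) a|%E.
      by exists a => //; rewrite /cballE/= subrr enorm0 ltW.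
    exact: abse_ge0.
  apply: le_scaled_inv => //; rewrite -EFinM.
  apply: ge_ereal_sup => _ [x xr <-]; rewrite !edistE_shift.
  have [] := H (x - a) xr.
  have gf := edistE_fin_num (x - a) (gr0 T P0).
  have Bf := edistE_fin_num (x - a) Bb.
  rewrite -(fineK gf) -(fineK Bf) -EFinB /= -!EFinD !lee_fin ler_norml (mulrC r).
  by move=> h1 h2; apply/andP; move: h1 h2; clear; split; lra.
- move=> _; apply: cvg_right => e e0; near=> r.
  have r0 : 0 < r by near: r; exact: near_right_gt0.
  have [b Bb br] : exists2 b, B b & enorm b <= r by near: r; exact: ne.
  have H : forall b, B b -> enorm b <= r ->
      (edistE (gr T P) b <= (e * enorm b ^+ k)%:E)%E.
    near: r; have [d d0 Hd] := BP e e0; apply/at_rightP; exists d => // r r0 rd c Bc cr.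
    by apply: Hd => //; exact: le_lt_trans rd.
  rewrite !add0r; apply/andP; split.
    apply: (@le_trans _ _ 0%E); first by rewrite lee_fin oppr_le0 ltW.
    apply: mule_ge0; first by rewrite lee_fin invr_ge0 exprn_ge0 // ltW.
    apply: le_ereal_sup_tmp; exists (edistE (tr a (gr T P)) (a + b)).
      exists (a + b) => //; split; last by exists b.
      by rewrite /cballE/= addrAC subrr add0r.
    exact: edistE_ge0.
  apply: le_scaled_inv; first exact: exprn_gt0.
  rewrite -EFinM; apply: ge_ereal_sup => _ [x [xr Bx] <-].
move: xr; have [c Bc <-] := Bx.
  rewrite edistE_shift /cballE/= addrAC subrr add0r => cr.
  apply: le_trans (H c Bc cr) _; rewrite lee_fin mulrC ler_wpM2r ?(ltW e0) //.
  by rewrite lerXn2r // nnegrE ?enorm_ge0 // ltW.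
move=> a0; have [C C0 H] := HC a0.
apply: (@le_lt_trans _ _ C%:E); last exact: ltry.
apply: limf_esup_right_le; near=> r.
have r0 : 0 < r by near: r; exact: near_right_gt0.
rewrite powRN; apply: le_scaled_inv; first exact: powR_gt0.
rewrite -EFinM; apply: ge_ereal_sup => _ [x [xr Bx] <-].
move: xr; have [c Bc <-] := Bx.
rewrite edistE_shift /cballE/= addrAC subrr add0r => cr.
apply: le_trans (H c Bc) _; rewrite lee_fin mulrC ler_wpM2r //.
by apply: ge0_ler_powR; rewrite ?nnegrE ?enorm_ge0 ?(ltW r0) // addr_ge0 // ltW.
Unshelve. all: by end_near. Qed.

(** The shear [phi] flattens the graph by one chart on the whole space; [P] takes values in the
    complement, so the [T]-component is only translated and the inverse [psi] is explicit. Both are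
    polynomial of degree at most [k], the identity because [k > 0]. *)
Lemma graph_submanifold k (alpha : R) T P a : (0 < k)%N -> maps_to_orth T P ->
  polyfun_on T k P -> submanifold k alpha (\dim T) (tr a (gr T P)).
Proof.
move=> k0 Po pP x _.
have pPT := polyfun_polymap pP.
pose phi (y : V) := (y - a) - P (orthproj T (y - a)).
pose psi (y : V) := (y + P (orthproj T y)) + a.
have pid : polymap k (id : V -> V).
  by apply: polymap_le k0 _; exact: (@polymap_linear _ _ _ idfun).
have Tphi y : orthproj T (phi y) = orthproj T (y - a).
  by rewrite /phi orthprojB (orthproj_orth (Po _ (orthproj_mem _ _))) subr0.
have Tpsi y : orthproj T (psi y - a) = orthproj T y.
  by rewrite /psi addrK orthprojD (orthproj_orth (Po _ (orthproj_mem _ _))) addr0.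
exists setT, setT, phi, psi, T; split.
- by split; [exact: openT|].
- exact: openT.
- exact: erefl.
- split.
  + apply/seteqP; split=> // y _; exists (psi y) => //.
    by rewrite /phi Tpsi /psi !addrK.
  + by move=> y _; rewrite /psi Tphi /phi subrK subrK.
  + apply: polymap_class_Calpha.
    apply: (@polymap_shift _ _ _ k (id - (P \o orthproj T)) (- a)).
    apply: polymapD; first exact: pid.
    by rewrite -scaleN1r; exact: polymapZ.
  + apply: polymap_class_Calpha.
    apply: (@polymapD _ _ _ k (id + (P \o orthproj T)) (cst a)).
      exact: polymapD.
    exact: polymap_cst.
apply/seteqP; split=> [_ [y [[_ [z zT <-] <-] _] <-]|y [_ yT]].
  split=> //=; rewrite /phi [a + _]addrC addrK orthproj_graph ?Po // addrK.
  exact: zT.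
exists (psi y); last by rewrite /phi Tpsi /psi !addrK.
split=> //; exists (y + P y); first by exists y.
by rewrite /psi (orthproj_id yT) addrC.
Qed.

Lemma good_is_Tan m k T P A B a : good m k T P A B ->
  is_Tan (tr a B) a [set x | x \in T].
Proof.
move=> G; pose d v := enorm (orthproj (orthv T) v).
have lim v (e : R) : 0 < e -> \forall r \near (0 : R)^'+,
    ((d v - e)%:E <= (r^-1)%:E * edistE (tr a B) (a + r *: v) <= (d v + e)%:E)%E.
  move=> e0; apply: filterS (good_tan_dist v G e0) => r.
  by rewrite edistE_shift addrAC subrr add0r.
have dT v : d v = 0 <-> v \in T.
  split=> [/enorm_eq0/orthprojv_eq0 //|vT].
  by rewrite /d orthproj_orthv orthproj_id // subrr enorm0.
split; apply/seteqP; split=> v /=; rewrite /upper_Tan /lower_Tan /=.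
- by rewrite (limf_einf_right (lim v)) => -[/dT].
- by move=> /dT dv; rewrite (limf_einf_right (lim v)) dv.
- move=> cv; apply/dT/eqP; rewrite eq_le enorm_ge0 andbT.
  apply/ler_addgt0Pr => e e0; rewrite add0r.
  have e2 : 0 < e / 2 by rewrite divr_gt0.
  have /filter_ex[//] : \forall r \near (0 : R)^'+, d v <= e.
  apply: filterS2 (cvg_right_inv cv e2) (lim v _ e2) => r h1 /andP[h2 _].
  have := le_lt_trans h2 h1; rewrite lte_fin; move: (d v) => x.
  by clear; lra.
- by move=> /dT dv; have := cvg_right (lim v); rewrite dv.
Qed.

(** A circle of inclusions: [T] into the lower cone, the lower cone into the upper one, and the
    upper one into [T]. *)
Lemma good_is_aTan m k T P A B a : good m k T P A B ->
  is_aTan m (meas_restr (hausdorff m) (tr a B)) a [set x | x \in T].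
Proof.
move=> G; have [m_gt0 k_gt0 Po P0 PQ c1 BA AB BP] := G.
have bv := ap_cond1_ball_vol c1.
set phi := meas_restr _ _.
have lu : lower_aTan m phi a `<=` upper_aTan m phi a.
  move=> v vl eps eps0; have [eta [eta0 H]] := vl eps eps0.
  (* The ball of radius [eps s / L] about [a + (s / L) v] lies in the cone about [v] and, by the
     choice of [L], in the ball of radius [s] about [a]. *)
  pose L := enorm v + eps; have L0 : 0 < L by rewrite ltr_wpDl ?enorm_ge0.
  pose c := eta / L ^+ m / ball_vol m.
  have c0 : 0 < c by rewrite !divr_gt0 // exprn_gt0.
  apply: (@lt_le_trans _ _ c%:E); first by rewrite lte_fin.
  apply: limf_esup_right_ge; near=> s.
  have s0 : 0 < s by near: s; exact: near_right_gt0.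
  have sL : s < eta * L by near: s; apply: near_right_lt; rewrite mulr_gt0.
  have r0 : 0 < s / L by rewrite divr_gt0.
  have := H (s / L); rewrite r0 ler_pdivrMr // (ltW sL) => /(_ isT) h.
  rewrite /density_ratio lee_pdivlMr; last by rewrite mulr_gt0 // exprn_gt0.
  have -> : (c%:E * (ball_vol m * s ^+ m)%:E = (eta * (s / L) ^+ m)%:E)%E.
    rewrite -EFinM /c expr_div_n; congr (_%:E); field.
    by rewrite expf_neq0 ?gt_eqF.
  apply: le_trans h _; apply: le_hausdorff => x [Bx xr]; split=> //.
  split.
    exists (s / L)^-1; rewrite invr_gt0; split=> //.
    rewrite -[v in X in enorm X](scalerK (lt0r_neq0 r0)) -scalerBr enormZ.
    rewrite gtr0_norm ?invr_gt0 // mulrC ltr_pdivrMr //.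
    by move: xr; rewrite /oballE/= opprD addrA.
  rewrite /cballE/=.
  have -> : x - a = (s / L) *: v + (x - (a + (s / L) *: v)).
    by apply/rowP => j; rewrite !mxE; ring.
  apply: le_trans (enormD _ _) _; rewrite enormZ gtr0_norm //.
  rewrite -[leRHS](divfK (lt0r_neq0 L0)) /L mulrDr lerD2l ltW //.
  by rewrite [ltRHS]mulrC; exact: xr.
have uT : upper_aTan m phi a `<=` [set x | x \in T].
  move=> v vu /=; apply/negPn/negP => vT.
  pose d := enorm (orthproj (orthv T) v).
  have d0 : 0 < d.
    by apply: enorm_gt0; apply: contra vT => /eqP; exact: orthprojv_eq0.
  have d2 : 0 < d / 2 by rewrite divr_gt0.
  have := vu _ d2; apply/negP; rewrite -leNgt; apply: limf_esup_right_le.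
  (* If [s b] is within [d / 2] of [v], then [|s b| <= |v| + d], so its component normal to [T] is
     at most [d / 4]; together with the error [d / 2] this cannot reach [d]. *)
  pose e := d / (4 * (enorm v + d)).
  have vd0 : 0 < enorm v + d by rewrite ltr_wpDl ?enorm_ge0.
  have e0 : 0 < e by rewrite divr_gt0 // mulr_gt0.
  have [t t0 H] := good_flat G e0.
  near=> r.
  rewrite /density_ratio (_ : meas_restr _ _ _ = 0%E) ?mul0e //.
  rewrite /phi /meas_restr (_ : tr a B `&` _ = set0) ?hausdorff0 //.
  apply/seteqP; split=> // _ [[b Bb <-]].
  rewrite /cone_nbhd /cballE /=.
  have -> : a + b - a = b by rewrite addrAC subrr add0r.
  move=> [[s [s0 sb]] br].
  have bt : enorm b < t by apply: le_lt_trans br _; near: r; exact: near_right_lt.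
  have hb := H b Bb bt.
  have h1 : d <= enorm (orthproj (orthv T) (s *: b)) + enorm (s *: b - v).
    apply: le_trans (le_enorm_add _ (orthproj (orthv T) (s *: b))) _.
    rewrite lerD2l -orthprojB (enormBC _ v); exact: enorm_orthproj.
  have h2 : s * enorm b <= enorm v + d / 2.
    rewrite -(gtr0_norm s0) -enormZ; apply: le_trans (le_enorm_add _ v) _.
    by rewrite lerD2l ltW.
  have h3 : enorm (orthproj (orthv T) (s *: b)) <= d / 4.
    rewrite orthprojZ enormZ gtr0_norm //.
    apply: (@le_trans _ _ (e * (s * enorm b))).
      by rewrite mulrCA ler_wpM2l // ltW.
    apply: (@le_trans _ _ (e * (enorm v + d))).
      rewrite ler_wpM2l ?(ltW e0) //; apply: le_trans h2 _.
      by move: (d0); clear; lra.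
    by rewrite /e le_eqVlt; apply/orP; left; apply/eqP; field; rewrite gt_eqF.
  by move: h1 h3 sb (d0); clear; lra.
have Tl : [set x | x \in T] `<=` lower_aTan m phi a.
  move=> v /= vT eps eps0.
  pose L := enorm v + 1; have L0 : 0 < L by rewrite ltr_wpDl ?enorm_ge0.
  (* At scale [L r] the cylinder has half widths [eps r / 4], hence lies in the ball of radius
     [eps r]. *)
  have e4 : 0 < eps / (4 * L) by rewrite divr_gt0 // mulr_gt0.
  have [eta eta0 /(near_rightM L0)/at_rightP[d d0 H]] := good_cyl G e4.
  have eL : 0 < eta * L ^+ m by rewrite mulr_gt0 // exprn_gt0.
  exists (Num.min (d / 2) (eta * L ^+ m)); split.
    by rewrite lt_min eL divr_gt0.
  move=> r; rewrite le_min => /and3P[r0 rd re].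
  have rd' : r < d by apply: le_lt_trans rd _; rewrite ltr_pdivrMr // ltr_pMr // ltr1n.
  have rv : enorm (r *: v) <= L * r.
    by rewrite enormZ gtr0_norm // mulrC ler_wpM2r ?(ltW r0) // lerDl.
  have := H r r0 rd' (r *: v) (memvZ _ vT) rv.
  move=> h; apply: le_trans (le_trans h _).
    rewrite lee_fin exprMn mulrA ler_wpM2r ?exprn_ge0 ?(ltW r0) //.
    by rewrite ge_min lexx orbT.
  apply: (@le_hausdorff_shift _ a) => x [cx Bx]; split; first by exists x.
  rewrite /oballE/=.
  have -> : a + x - (a + r *: v) = x - r *: v by rewrite opprD addrACA subrr add0r.
  apply: le_lt_trans (enorm_cyl cx) _.
  rewrite (_ : _ + _ = eps * r / 2); last by field; rewrite gt_eqF.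
  have er : 0 < eps * r by rewrite mulr_gt0.
  by move: er; clear; lra.
split; apply/seteqP; split=> //.
- by move=> v /Tl/lu.
- by move=> v /lu/uT.
Unshelve. all: by end_near. Qed.

Lemma good_density m k T P A B a (A' := tr a A) : good m k T P A B ->
  has_density m (meas_restr (hausdorff m) (A' `\` tr a B)) a 0%E.
Proof.
move=> G; have [m_gt0 k_gt0 Po P0 PQ c1 BA AB BP] := G.
have bv := ap_cond1_ball_vol c1.
pose f r := hausdorff m ((A' `\` tr a B) `&` cballE a r).
have f0 r : (0 <= f r)%E by exact: hausdorff_ge0.
apply: (density_cvg0P m bv f0).2.
move=> e e0; apply: filterS (AB e e0) => r; apply: le_trans.
apply: (@le_hausdorff_shift _ (- a)) => _ [[[x Ax <-] nB] xr].
rewrite addKr; split.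
  by split=> // Bx; apply: nB; exists x.
by move: xr; rewrite /cballE/= subr0 addrAC subrr add0r.
Qed.

End PointwiseDifferentiable.

(** * Comparison of the differentials *)

Section Differentials.
Context {R : realType} {n : nat}.
Local Notation V := 'rV[R]_n.
Implicit Types (m k i : nat) (T : {vspace V}) (P f : V -> V) (A B : set V) (a v : V).

Local Notation tr a B := [set a + x | x in B].

Lemma pt_cond_edist k M B a (e : R) : pt_cond k 0 M B a -> 0 < e ->
  \forall r \near (0 : R)^'+, forall x, B x -> enorm (x - a) <= r ->
    (edistE M x <= (e * r ^+ k)%:E)%E.
Proof.
move=> [_ /(_ erefl) lim _] e0; near=> r.
have r0 : 0 < r by near: r; exact: near_right_gt0.
have H : ((r ^- k)%:E * ereal_sup [set edistE M x | x in cballE a r `&` B]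
    < (0 + e)%:E)%E.
  by near: r; exact: (cvg_right_inv lim e0).
move=> x Bx xr.
apply: (@le_trans _ _ (ereal_sup [set edistE M x | x in cballE a r `&` B])).
  by apply: ereal_sup_ubound; exists x.
have rk : 0 < r ^+ k by rewrite exprn_gt0.
by move: H; rewrite add0r lte_pdivrMl // -EFinM mulrC => /ltW.
Unshelve. all: by end_near. Qed.

Lemma graph_value T f a : maps_to_orth T f -> gr T f a ->
  f (orthproj T a) = a - orthproj T a.
Proof. by move=> fo [w wT <-]; rewrite orthproj_graph ?fo // addrC addKr. Qed.

(** The cylinder about [z] meets [B] in more measure than [A] has away from the graph of [Pi], so it
    contains a point [b] of [B] close to both graphs. Projecting the difference of the two nearby
    graph points to [T] and to its complement compares their base points and their values; the
    Lipschitz bound for [Pi] then brings both values over the same base point. *)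
Lemma good_graphs_close m k i T P f Pi A B a : (1 <= i <= k)%N ->
  good m k T P [set x - a | x in A] B ->
  maps_to_orth T f -> gr T f a -> pt_cond k 0 (gr T f) (tr a B) a ->
  ap_diff_with m i 0 T Pi A a ->
  forall e : R, 0 < e -> \forall r \near (0 : R)^'+,
    forall z, z \in T -> enorm z <= r -> exists y, [/\ y \in T,
      enorm (y - z) <= e * r &
      enorm (f (y + orthproj T a) - f (orthproj T a) - Pi y) <= e * r ^+ i].
Proof.
move=> /andP[i1 ik] G fo fa ptf [_ [Pio pPi] [Pi0 dPi] _ c2] e e0.
set A1 := [set x - a | x in A] in G c2.
have [m_gt0 _ _ _ _ c1 BA _ _] := G.
have bv := ap_cond1_ball_vol c1.
have [C [r1 [C0 r10 Lip]]] := polyfun_quadratic pPi Pi0 dPi.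
(* [2 ^ i] absorbs the scale [2 r]; each graph point is within [2 t] of [b], so bases and values
   differ by at most [4 t], and [1 + C] pays for moving the base point of [Pi]. The bound by 1 keeps
   the base points within [3 r]. *)
pose e1 := Num.min 1 e / (4 * (1 + C) * 2 ^+ i).
have C1 : 0 < 1 + C by rewrite ltr_pwDl.
have min0 : 0 < Num.min 1 e by rewrite lt_min ltr01.
have pi0 : 0 < 2 ^+ i :> R by rewrite exprn_gt0.
have D0 : 0 < 4 * (1 + C) * 2 ^+ i by rewrite !mulr_gt0.
have e10 : 0 < e1 by rewrite divr_gt0.
pose eps := Num.min 1 e / 4.
have eps0 : 0 < eps by rewrite divr_gt0.
have two : 0 < 2 :> R by [].
have [eta eta0 H1] := good_cyl G eps0.
have et0 : 0 < eta / 2 / 2 ^+ m by rewrite !divr_gt0 // exprn_gt0.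
have H2 := near_rightM two (ap_cond2_littleo bv c2 e10 et0).
have H3 := near_rightM two (pt_cond_edist ptf e10).
near=> r; have r0 : 0 < r by near: r; exact: near_right_gt0.
have rle : r < 1 / 3 by near: r; apply: near_right_lt; rewrite divr_gt0.
have rr1 : r < r1 / 3 by near: r; apply: near_right_lt; rewrite divr_gt0.
have H1r : forall z, z \in T -> enorm z <= r ->
    ((eta * r ^+ m)%:E <= hausdorff m (cyl T z (eps * r) (eps * r) `&` B))%E.
  by near: r.
have H2r : (hausdorff m (off_graph T Pi (e1 * (2 * r) ^+ i) (2 * r) A1) <=
    (eta / 2 / 2 ^+ m * (2 * r) ^+ m)%:E)%E by near: r.
have H3r : forall x, tr a B x -> enorm (x - a) <= 2 * r ->
    (edistE (gr T f) x <= (e1 * (2 * r) ^+ k)%:E)%E by near: r.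
move=> z zT zr.
have epsle : eps <= 1 / 4 by rewrite /eps ler_pM2r // ge_min lexx.
have epsle' : eps <= e / 4 by rewrite /eps ler_pM2r // ge_min lexx orbT.
have br x : cyl T z (eps * r) (eps * r) x -> enorm (x - z) <= 2 * (eps * r).
  by move=> /enorm_cyl; rewrite mulrDl mul1r.
have er4 : eps * r <= 1 / 4 * r by rewrite ler_wpM2r // ltW.
have br2 x : cyl T z (eps * r) (eps * r) x -> enorm x <= 2 * r.
  move=> /br cx; have := le_enorm_add x z; move: cx er4 zr (r0); clear; lra.
have [b [[cb Bb] nb]] : exists b, (cyl T z (eps * r) (eps * r) `&` B) b /\
    (edistE (gr T Pi) b <= (e1 * (2 * r) ^+ i)%:E)%E.
  apply: contrapT => nex.
  have sub : cyl T z (eps * r) (eps * r) `&` B `<=`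
      off_graph T Pi (e1 * (2 * r) ^+ i) (2 * r) A1.
    move=> x [cx Bx]; split.
      split; first exact: BA.
      by rewrite /cballE/= subr0; exact: br2.
    by rewrite /= ltNge; apply/negP => h; apply: nex; exists x.
  have := le_trans (H1r z zT zr) (le_trans (le_hausdorff m sub) H2r).
  apply/negP; rewrite lee_fin -ltNge exprMn mulrA divfK ?expf_neq0 //.
  have : 0 < eta * r ^+ m by rewrite mulr_gt0 // exprn_gt0.
  by rewrite mulrAC; clear; lra.
have b2r := br2 b cb; have bz := br b cb.
pose t := e1 * (2 * r) ^+ i.
have t0 : 0 < t by rewrite mulr_gt0 // exprn_gt0 // mulr_gt0.
have fb : (edistE (gr T f) (a + b) <= t%:E)%E.
  apply: le_trans (H3r (a + b) _ _) _; first by exists b.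
    by rewrite addrAC subrr add0r.
  rewrite lee_fin ler_wpM2l ?(ltW e10) //; apply: ler_wiXn2l => //.
    by rewrite mulr_ge0 // ltW.
  by move: rle; clear; lra.
have tt : t < 2 * t by move: (t0); clear; lra.
have [y yT by_] := near_graph nb tt.
have [y' y'T by'] := near_graph fb tt.
(* Since [a] lies on the graph of [f], subtracting it from [y' + f y'] leaves the base point [y1]
   and the value [F]. *)
pose y1 := y' - orthproj T a.
have y1T : y1 \in T by rewrite memvB // orthproj_mem.
pose F := f (y1 + orthproj T a) - f (orthproj T a).
have Fo : F \in orthv T.
  by rewrite memvB // fo ?orthproj_mem // memvD // orthproj_mem.
have by1 : enorm (b - (y1 + F)) < 2 * t.
  rewrite (_ : b - _ = a + b - (y' + f y')) //.
  rewrite /F /y1 subrK (graph_value fo fa).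
  by apply/rowP => j; rewrite !mxE; ring.
have ri : r ^+ i <= r.
  apply: (@le_trans _ _ (r ^+ 1)); last by rewrite expr1.
  apply: ler_wiXn2l; [exact: ltW| |exact: i1].
  by move: rle; clear; lra.
have tE : t = Num.min 1 e / (4 * (1 + C)) * r ^+ i.
  rewrite /t /e1 exprMn; field.
  by rewrite gt_eqF // expf_neq0.
have t4 : 4 * (1 + C) * t <= e * r ^+ i.
  rewrite tE mulrA mulrCA divff ?mulr1; last by rewrite gt_eqF // mulr_gt0.
  by rewrite ler_wpM2r ?exprn_ge0 ?(ltW r0) // ge_min lexx orbT.
have tC : 0 <= C * t by rewrite mulr_ge0 // ltW.
have t4r : 4 * t <= e * r.
  apply: (@le_trans _ _ (e * r ^+ i)); last by rewrite ler_wpM2l // ltW.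
  by move: t4 tC; clear; lra.
have t1r : 4 * t <= r.
  apply: (@le_trans _ _ (4 * (1 + C) * t)).
    by move: tC; clear; lra.
  apply: le_trans ri; rewrite tE mulrA mulrCA divff ?mulr1; last by rewrite gt_eqF // mulr_gt0.
  by rewrite ler_piMl ?exprn_ge0 ?(ltW r0) // ge_min lexx.
have Piy := Pio y yT.
have eyy : enorm (y - y1) <= 4 * t.
  have -> : y - y1 = orthproj T ((b - (y1 + F)) - (b - (y + Pi y))).
    rewrite orthprojB !(orthprojB T b) !orthproj_graph //.
    by apply/rowP => j; rewrite !mxE; ring.
  apply: le_trans (enorm_orthproj _ _) _; apply: le_trans (enormB _ _) _.
  by move: by_ by1; clear; lra.
have ePF : enorm (F - Pi y) <= 4 * t.
  have -> : F - Pi y = orthproj (orthv T) ((b - (y + Pi y)) - (b - (y1 + F))).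
    rewrite orthprojB !(orthprojB (orthv T) b) !orthprojv_graph //.
    by apply/rowP => j; rewrite !mxE; ring.
  apply: le_trans (enorm_orthproj _ _) _; apply: le_trans (enormB _ _) _.
  by move: by_ by1; clear; lra.
have y3 : enorm y <= 3 * r.
  apply: le_trans (enorm_graph_base b Pio yT) _.
  by move: by_ b2r t1r (t0); clear; lra.
have y13 : enorm y1 <= 3 * r.
  rewrite -(orthproj_graph y1T Fo); apply: le_trans (enorm_orthproj _ _) _.
  apply: le_trans (le_enorm_add _ b) _; rewrite enormBC.
  by move: by1 b2r t1r (t0); clear; lra.
have r3 : 3 * r < r1 by rewrite mulrC -ltr_pdivlMr.
exists y1; split=> //.
  have -> : y1 - z = orthproj T ((y1 + F) - z).
    by rewrite orthprojB orthproj_graph // orthproj_id.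
  apply: le_trans (enorm_orthproj _ _) _; apply: le_trans (enormB_trans b _ _) _.
  rewrite enormBC.
  have : eps * r <= e / 4 * r by rewrite ler_wpM2r // ltW.
  by move: by1 bz t4r; clear; lra.
have -> : f (y1 + orthproj T a) - f (orthproj T a) - Pi y1 =
    (F - Pi y) + (Pi y - Pi y1).
  by apply/rowP => j; rewrite !mxE; ring.
apply: le_trans (enormD _ _) _.
have L := Lip (3 * r) y1 y r3 y1T yT y13 y3.
have Ct : C * (3 * r) * enorm (y - y1) <= C * (4 * t).
  rewrite -mulrA ler_wpM2l //; apply: le_trans eyy.
  rewrite ler_piMl ?enorm_ge0 //; by move: rle; clear; lra.
by move: L Ct ePF t4; clear; lra.
Unshelve. all: by end_near. Qed.

Lemma iterdiff_cst (u : V) vs : (0 < size vs)%N -> iterdiff (cst u : V -> V) vs = cst 0.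
Proof.
elim: vs => // v [|w vs] IH _; apply/funext => x.
  by have := congr1 (fun h : V -> V => h v) (diff_cst u x).
rewrite [LHS](_ : _ = 'd (iterdiff (cst u : V -> V) (w :: vs)) x v); last exact: erefl.
rewrite IH //; exact: (congr1 (fun h : V -> V => h v) (diff_cst (0 : V) x)).
Qed.

(** The difference [g] of the translated functions, normalised to vanish at 0, is small on points
    dense enough in [T], so its differentials up to order [i] vanish at 0. The constant subtracted
    does not affect order [i >= 1]. *)
Lemma good_Diter m k i T P f Pi A B a : (1 <= i <= k)%N ->
  good m k T P [set x - a | x in A] B ->
  maps_to_orth T f -> class_C k setT (f \o orthproj T) -> gr T f a ->
  pt_cond k 0 (gr T f) (tr a B) a -> ap_diff_with m i 0 T Pi A a ->
  Diter (f \o orthproj T) a = Diter (Pi \o orthproj T) (0 : V) :> (i.-tuple V -> V).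
Proof.
move=> /[dup] ik /andP[i1 ilek] G fo Cf fa ptf apPi.
have close := good_graphs_close ik G fo fa ptf apPi.
have [_ [Pio pPi] [Pi0 _] _ _] := apPi.
pose u := f (orthproj T a).
pose fs : V -> V := fun x => (f \o orthproj T) (x + a).
pose g : V -> V := (fs - cst u) - (Pi \o orthproj T).
have gE x : g x = f (orthproj T (x + a)) - u - Pi (orthproj T x) by [].
have Cfi := class_C_le ilek Cf.
have Cs : class_C i setT fs by exact: class_C_shift.
have Cc : class_C i setT (cst u : V -> V) by exact: polymap_class_C (polymap_cst 0 u).
have CP : class_C i setT (Pi \o orthproj T).
  exact: polymap_class_C (polyfun_polymap pPi).
have Csc := class_CB Cs Cc.
have Cg : class_C i setT g := class_CB Csc CP.
have g0 : g 0 = 0 by rewrite gE add0r orthproj0 Pi0 subrr subr0.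
have Z : forall vs, (size vs <= i)%N -> iterdiff g vs 0 = 0.
  apply: (dense_iterdiff0 Cg g0) => e e0.
  pose N : R := n.+1%:R; have N0 : 0 < N by [].
  have Ni : 0 < N ^+ i by rewrite exprn_gt0.
  have e'0 : 0 < e / N ^+ i by rewrite divr_gt0.
  have /at_rightP[d d0 H] := close _ e'0.
  exists (d / N); first exact: divr_gt0.
  move=> z zd; have [->|z0] := eqVneq z 0.
    by exists 0; rewrite ?g0 ?subrr normr0 ?mulr0 // mulr_ge0 // ?exprn_ge0 // ltW.
  have zN : enorm z <= N * `|z| by exact: enorm_le_norm.
  have zd' : enorm z < d by apply: le_lt_trans zN _; rewrite mulrC -ltr_pdivlMr.
  have [y [yT yz gy]] := H _ (enorm_gt0 z0) zd' _ (orthproj_mem T z) (enorm_orthproj T z).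
  have piy : orthproj T (y + (z - orthproj T z)) = y.
    by rewrite orthproj_graph // sub_orthproj_mem.
  (* [g] depends only on the [T]-component, so [y] may be given the normal component of [z]; this
     turns density in [T] into density in the whole space. *)
  exists (y + (z - orthproj T z)).
    apply: le_trans (norm_le_enorm _) _.
    have -> : y + (z - orthproj T z) - z = y - orthproj T z.
      by apply/rowP => j; rewrite !mxE; ring.
    apply: le_trans yz _; rewrite -mulrA ler_wpM2l ?(ltW e0) //.
    rewrite mulrC ler_pdivrMr // mulrC; apply: le_trans zN _.
    rewrite ler_wpM2r //; apply: (@le_trans _ _ (N ^+ 1)); first by rewrite expr1.
    by apply: ler_weXn2l => //; rewrite ler1n.
  apply: le_trans (norm_le_enorm _) _; rewrite gE orthprojD piy.
  apply: le_trans gy _; rewrite -mulrA ler_wpM2l ?(ltW e0) //.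
  rewrite mulrC ler_pdivrMr // mulrC -exprMn.
  by rewrite lerXn2r ?nnegrE ?enorm_ge0 // mulr_ge0 // ltW.
apply/funext => vs; have := Z vs; rewrite size_tuple => /(_ (leqnn _)).
have si : (size vs <= i)%N by rewrite size_tuple.
rewrite (iterdiffB Csc CP si) (iterdiffB Cs Cc si) (iterdiff_shift a Cfi si).
rewrite iterdiff_cst ?size_tuple // => E.
have {}E : iterdiff (f \o orthproj T) vs (0 + a) - 0 -
    iterdiff (Pi \o orthproj T) vs 0 = 0 by exact: E.
by move: E; rewrite add0r subr0 => /eqP; rewrite subr_eq0 => /eqP.
Qed.

End Differentials.

Theorem theorem4p11 (R : realType) (n m k : nat) (alpha : R)
  (A : set 'rV[R]_n) (a : 'rV[R]_n)
  (hm : (1 <= m <= n)%N) (hk : (1 <= k)%N) (halpha : 0 <= alpha <= 1)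
  (hA : ap_diff k alpha A a) (hdim : m = \dim (apTan A a)) :
  exists B : set 'rV[R]_n,
    [/\ B `<=` A,
        pt_diff k alpha B a,
        has_density m (meas_restr (hausdorff m) (A `\` B)) a 0%E,
        is_Tan B a [set x | x \in apTan A a]
          /\ is_aTan m (meas_restr (hausdorff m) B) a [set x | x \in apTan A a]
      & forall i : nat, (2 <= i <= k)%N ->
          ptD k i B a (apTan A a) = apD i A a].
Proof.
have [m' [T [P ap]]] := hA.
have TE : apTan A a = T := apTan_eq hk ap.
have mE : m' = m by rewrite hdim TE; case: ap => -[].
rewrite {}mE in ap; have [[_ dT] [Po pP] [P0 dP] c1 c2] := ap.
have /andP[alpha0 _] := halpha.
have [B [BA AB BP Balpha]] := good_subset alpha0 hk ap.
have /andP[m0 _] := hm.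
have G := Good m0 hk Po P0 (ap_diff_quadratic ap) c1 BA AB BP.
have AE : [set a + x | x in [set x - a | x in A]] = A.
  rewrite image_comp; apply/seteqP; split=> [_ [x Ax <-]|x Ax] /=.
    by rewrite addrC subrK.
  by exists x => //=; rewrite addrC subrK.
exists [set a + x | x in B]; rewrite TE; split.
- by rewrite -[X in _ `<=` X]AE; exact: image_subset.
- exists (\dim T), [set a + x | x in gr T P]; split.
  + exact: graph_submanifold.
  + by exists 0; rewrite ?addr0 //; exact: gr0.
  + exact: good_pt_cond G Balpha.
- by have := good_density a G; rewrite AE.
- by split; [exact: good_is_Tan G|exact: good_is_aTan G].
move=> i /andP[i2 ik]; have ik' : (1 <= i <= k)%N by rewrite (ltnW i2) ik.
rewrite /ptD /apD TE.
(* The chosen polynomial has the defining properties as soon as some polynomial does; the truncation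
   of [P] to order [i] is one. *)
have apPi : ap_diff_with m i 0 T (apPoly i A a) A a.
  have [P' apP'] := ap_diff_trunc ik' ap.
  rewrite /apPoly TE dT; 
  exact: (@xgetPex _ (fun=> 0) [set Q | ap_diff_with m i 0 T Q A a]
    (ex_intro _ P' apP')).
(* The graph of [P] translated by [a], written as a graph over [T]: the base point is shifted by the
   [T]-component of [a], the value by the normal one. *)
pose f0 (x : 'rV[R]_n) := (a - orthproj T a) + P (x - orthproj T a).
pose fs := [set f : 'rV[R]_n -> 'rV[R]_n | [/\ maps_to_orth T f,
    class_C k setT (f \o orthproj T), gr T f a &
    pt_cond k 0 (gr T f) [set a + x | x in B] a]].
have f0P : fs f0.
  split.
  - move=> x xT; rewrite memvD ?sub_orthproj_mem //.
    by apply: Po; rewrite memvB // orthproj_mem.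
  - apply: (@polymap_class_C _ _ k).
    have -> : f0 \o orthproj T =
        (cst (a - orthproj T a)) + (fun x => (P \o orthproj T) (x + - a)).
      by apply/funext => x; rewrite /f0/= -orthprojB.
    apply: polymapD; first exact: polymap_cst.
    exact: polymap_shift (polyfun_polymap pP).
  - by exists (orthproj T a); rewrite /= ?orthproj_mem // /f0 subrr P0 addr0 addrC subrK.
  have -> : gr T f0 = [set a + x | x in gr T P].
    apply/seteqP; split=> [_ [x xT <-]|_ [_ [x xT <-] <-]].
      exists ((x - orthproj T a) + P (x - orthproj T a)).
        by exists (x - orthproj T a) => //; rewrite /= memvB // orthproj_mem.
      by rewrite /f0; apply/rowP => j; rewrite !mxE; ring.
    exists (x + orthproj T a); first by rewrite /= memvD // orthproj_mem.
    by rewrite /f0 addrK; apply/rowP => j; rewrite !mxE; ring.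
  by apply: (good_pt_cond _ G); rewrite ltxx.
(* The function picked by [pt_fun] may differ from [f0], but it satisfies the same conditions, which
   is all that the comparison uses. *)
have [fo Cf fa ptf] : fs (pt_fun k [set a + x | x in B] a T).
  exact: (@xgetPex _ (fun=> 0) fs (ex_intro _ f0 f0P)).
exact: good_Diter ik' G fo Cf fa ptf apPi.
Qed.
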